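(* Let $V:\mathbb R^d\to\mathbb R$ satisfy (H1) of the context and assume that $V$ has exactly one saddle point $\mathbf s$. Let $\ell(x,v)=\ell_x\cdot(x-\mathbf s)+\ell_v\cdot v$, with $\ell_x,\ell_v\in\mathbb R^d$, be a linear form in the variables $(x-\mathbf s,v)$, and set $$\varphi(x,v)=\theta(x,v)\,e^{-W(x,v)/h},\qquad\theta(x,v)=\int_0^{\ell(x,v)}e^{-\frac{s^2}{2h}}\,ds .$$ Then $$Q_h\varphi(x,v)=-h\int_0^1\partial_y(L_y)\,e^{-\frac{W(x,v)+\frac12L_y^2(x,v)}h}\,dy\cdot\begin{pmatrix}x-\mathbf s\\ v\end{pmatrix},$$ where, with a slight abuse of notation, $L_y$ denotes both the linear form $$L_y(x,v)=\frac{(1+y)\,\ell_x\cdot(x-\mathbf s)+(1-y)\,\ell_v\cdot v}{\big(4y|\ell_v|^2+(y+1)^2\big)^{1/2}}$$ and the vector of $\mathbb R^{2d}$ representing it (in the variables $(x-\mathbf s,v)$). Moreover, for $y\in(0,1]$, denoting $m_{y,h}(v,\eta)=2(y+1)^{d-2}e^{-\frac yh\left(\frac{|v|^2}2+2|\eta|^2\right)}$, $$\mathrm{Op}_h(m_{y,h}\,\mathrm{Id})\circ b_h\,\varphi(x,v)=2h(2\pi h)^{-d/2}e^{-\frac{V(x)}{2h}}\frac{(y+1)^{d-2}}{(4y)^{d/2}}\int_{v'\in\mathbb R^d}e^{-\frac1h\left(\frac{|v'|^2}4+\frac y8|v+v'|^2+\frac{|v-v'|^2}{8y}+\frac12\ell^2(x,v')\right)}\,dv'\;\ell_v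 .$$
   Context: (H1) $V$ is a smooth Morse function on $\mathbb R^d$, real valued, bounded from below, with $|\partial_xV(x)|\ge1/C$ for $|x|>C$ for some $C>0$; for all $|\alpha|\ge2$ there is $C_\alpha$ with $|\partial_x^\alpha V|\le C_\alpha$; and $V$ has at least two local minima. A saddle point is a critical point of index $1$. $W(x,v)=V(x)/2+|v|^2/4$ on $\mathbb R^{2d}$. $h>0$. $\Pi_h$ is the orthogonal projection of $L^2(\mathbb R^{2d})$ onto $\mu_h\,L^2(\mathbb R^d_x)$, $\mu_h(v)=(2\pi h)^{-d/4}e^{-|v|^2/(4h)}$, and $Q_h=h(\mathrm{Id}-\Pi_h)$ (acting in $v$ only, $x$ being a parameter). $b_h=h\partial_v+v/2$, mapping scalar functions to $d$-vector valued ones. $\mathrm{Op}_h(a)u(v)=(2\pi h)^{-d}\int_{\mathbb R^d}\int_{\mathbb R^d}e^{\frac ih(v-v')\cdot\eta}a(\frac{v+v'}2,\eta)u(v')\,dv'\,d\eta$ is the Weyl quantization in the variable $v$, applied entrywise to matrix-valued symbols; $\mathrm{Id}$ is the $d\times d$ identity. *)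

(* Defs.v *)
From HB Require Import structures.
From mathcomp Require Import all_boot all_order all_algebra.
From mathcomp Require Import all_classical all_reals all_analysis.
From mathcomp.real_closed Require Import complex.

Set Implicit Arguments.
Unset Strict Implicit.
Unset Printing Implicit Defensive.

Import Order.TTheory GRing.Theory Num.Theory.
Import numFieldNormedType.Exports.

Local Open Scope classical_set_scope.
Local Open Scope ring_scope.

Section leb.
Context {R : realType}.
Local Notation RT := (measurableTypeR R).

Definition tcons n (z : RT * n.-tuple RT) : n.+1.-tuple RT :=
  [the n.+1.-tuple RT of z.1 :: z.2].

Lemma measurable_tcons n : measurable_fun [set: RT * n.-tuple RT] (@tcons n).
Proof. by apply: measurable_cons; [exact: measurable_fst|exact: measurable_snd]. Qed.

Section step.
Context n (m : {sigma_finite_measure set (n.-tuple RT) -> \bar R}).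

Definition leb_step : set (n.+1.-tuple RT) -> \bar R :=
  pushforward (lebesgue_measure \x m)%E (@tcons n).

Let leb_step0 : leb_step set0 = 0%E.
Proof. by rewrite /leb_step /pushforward preimage_set0 measure0. Qed.

Let mpre A : measurable A -> measurable (@tcons n @^-1` A).
Proof. by move=> mA; rewrite -[X in measurable X]setTI; exact: measurable_tcons. Qed.

Let leb_step_ge0 A : (0 <= leb_step A)%E.
Proof. by rewrite /leb_step /pushforward measure_ge0. Qed.

Let leb_step_sigma_additive : semi_sigma_additive leb_step.
Proof.
move=> F mF tF mUF; rewrite /leb_step /pushforward preimage_bigcup.
apply: measure_semi_sigma_additive.
- by move=> k; exact: mpre.
- apply/trivIsetP => /= i j _ _ ij; rewrite -preimage_setI.
  by move/trivIsetP : tF => /(_ _ _ _ _ ij) ->//; rewrite preimage_set0.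
- by rewrite -preimage_bigcup; exact: mpre.
Qed.

HB.instance Definition _ := isMeasure.Build _ _ _ leb_step
  leb_step0 leb_step_ge0 leb_step_sigma_additive.

Let leb_step_sigma_finite : sigma_finite setT leb_step.
Proof.
have /sigma_finiteP[F [TF ndF Foo]] :
  sigma_finite setT (lebesgue_measure : {measure set RT -> \bar R}).
  exact: sigma_finiteT.
have /sigma_finiteP[G [TG ndG Goo]] := sigma_finiteT m.
pose g (t : n.+1.-tuple RT) := (thead t, [tuple of behead t] : n.-tuple RT).
have mg : measurable_fun setT g.
  by apply/measurable_fun_pair => /=;
    [exact: measurable_tnth|exact: measurable_behead].
have gK z : g (tcons z) = z.
  by case: z => a t; rewrite /g /tcons; congr pair; apply/val_inj.
exists (fun k => g @^-1` (F k `*` G k)).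
  rewrite predeqE => t; split => // _.
  have [i _ Fi] : (\bigcup_k F k) (g t).1 by rewrite -TF.
  have [j _ Gj] : (\bigcup_k G k) (g t).2 by rewrite -TG.
  exists (maxn i j) => //; split => /=.
    by move: Fi; exact/subsetPset/ndF/leq_maxl.
  by move: Gj; exact/subsetPset/ndG/leq_maxr.
move=> k; have [mFk Fkoo] := Foo k; have [mGk Gkoo] := Goo k; split.
  rewrite -[X in measurable X]setTI; apply: mg => //; exact: measurableX.
rewrite /leb_step /pushforward.
rewrite (_ : _ @^-1` _ = F k `*` G k).
  by rewrite product_measure1E// lte_mul_pinfty// ge0_fin_numE.
by rewrite -comp_preimage (_ : g \o _ = id) ?preimage_id//; exact/funext.
Qed.

HB.instance Definition _ := Measure_isSigmaFinite.Build _ _ _ leb_step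
  leb_step_sigma_finite.

End step.

Fixpoint leb n : {sigma_finite_measure set (n.-tuple RT) -> \bar R} :=
  match n with
  | 0 => [the {sigma_finite_measure set (0.-tuple RT) -> \bar R} of
            dirac [tuple]]
  | n'.+1 => [the {sigma_finite_measure set (n'.+1.-tuple RT) -> \bar R} of
            leb_step (leb n')]
  end.

(** [leb n] is the unique measure with this value on measurable boxes. *)
Lemma leb_box n (A : 'I_n -> set RT) : (forall i, measurable (A i)) ->
  leb n [set t | forall i, A i (tnth t i)] =
  (\prod_(i < n) lebesgue_measure (A i))%E.
Proof.
elim: n A => [|n IH] A mA.
  rewrite big_ord0 /= diracE mem_set//=.
  by move=> [].
have mB : measurable [set t : n.-tuple RT | forall i, A (lift ord0 i) (tnth t i)].
  rewrite (_ : [set t | _] =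
    \bigcap_(i in [set: 'I_n]) ((fun t : n.-tuple RT => tnth t i) @^-1` A (lift ord0 i))).
    apply: fin_bigcap_measurable => [|i _]; first exact: finite_finset.
    by rewrite -[X in measurable X]setTI; exact: measurable_tnth.
  by apply/seteqP; split => t /= H i; [move=> _; exact: H|exact: H].
rewrite big_ord_recl /= /leb_step /pushforward.
rewrite -IH// -product_measure1E//.
congr (_ _); apply/seteqP; split => -[a t] /=.
  move=> H; split; first exact: (H ord0).
  by move=> i; have := H (lift ord0 i); rewrite tnthS.
move=> [Ha Ht] i; case: (unliftP ord0 i) => [j ->|->] //.
by rewrite tnthS; exact: Ht.
Qed.

End leb.

Section calculus.
Context {R : realType}.

Definition dotp n (u v : 'rV[R]_n) : R := \sum_(i < n) u 0 i * v 0 i.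

(* The library norm on ['rV[R]_n] is the sup norm. *)
Definition enorm n (u : 'rV[R]_n) : R := Num.sqrt (dotp u u).

Definition partial n (i : 'I_n) (f : 'rV[R]_n -> R) : 'rV[R]_n -> R :=
  fun x => 'D_(delta_mx 0 i) f x.

(* [ipartial [:: i1; ...; ik] f] is d_i1 ... d_ik f; a multi-index alpha is
   represented by any sequence in which each i occurs alpha_i times. *)
Definition ipartial n (s : seq 'I_n) (f : 'rV[R]_n -> R) : 'rV[R]_n -> R :=
  foldr (@partial n) f s.

(* Frechet differentiability of every iterated partial derivative gives both
   the existence of the next partial derivatives and the continuity. *)
Definition smooth n (f : 'rV[R]_n -> R) : Prop :=
  forall (s : seq 'I_n) (x : 'rV[R]_n), differentiable (ipartial s f) x.

Definition grad n (f : 'rV[R]_n -> R) (x : 'rV[R]_n) : 'rV[R]_n :=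
  \row_i partial i f x.

Definition hess n (f : 'rV[R]_n -> R) (x : 'rV[R]_n) : 'M[R]_n :=
  \matrix_(i, j) ipartial [:: i; j] f x.

Definition critical n (f : 'rV[R]_n -> R) (x : 'rV[R]_n) : Prop :=
  grad f x = 0.

Definition morse n (f : 'rV[R]_n -> R) : Prop :=
  forall x, critical f x -> hess f x \in unitmx.

(* [A] has exactly [k] negative eigenvalues, counted with multiplicity. *)
Definition has_index n (A : 'M[R]_n) (k : nat) : Prop :=
  exists2 e : seq R, char_poly A = \prod_(a <- e) ('X - a%:P)
                   & count (fun a => a < 0) e = k.

Definition saddle n (f : 'rV[R]_n -> R) (x : 'rV[R]_n) : Prop :=
  critical f x /\ has_index (hess f x) 1.

Definition local_min n (f : 'rV[R]_n -> R) (x : 'rV[R]_n) : Prop :=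
  \forall y \near x, f x <= f y.

Record H1 n (V : 'rV[R]_n -> R) : Prop := {
  H1_smooth : smooth V;
  H1_morse : morse V;
  H1_bounded_below : exists m, forall x, m <= V x;
  H1_grad : exists2 C : R, 0 < C &
    forall x, C < enorm x -> C^-1 <= enorm (grad V x);
  H1_bounded_derivatives : forall s : seq 'I_n, (2 <= size s)%N ->
    exists C : R, forall x, `|ipartial s V x| <= C;
  H1_two_minima : exists x y, [/\ x <> y, local_min V x & local_min V y] }.

Definition oint (a b : R) (f : R -> R) : R :=
  if a <= b then \int[lebesgue_measure]_(s in `[a, b]) f s
  else - \int[lebesgue_measure]_(s in `[b, a]) f s.

End calculus.

Section integration.
Context {R : realType}.
Local Notation C := R[i].
Local Notation RT := (measurableTypeR R).

Definition cint dd (T : measurableType dd) (mu : {measure set T -> \bar R})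
    (f : T -> C) : C :=
  Complex (\int[mu]_t complex.Re (f t)) (\int[mu]_t complex.Im (f t)).

Definition L2 dd (T : measurableType dd) (mu : {measure set T -> \bar R}) :
    set (T -> C) :=
  [set f | (fun t => complex.Re (f t)) \in Lfun mu 2%:E /\
           (fun t => complex.Im (f t)) \in Lfun mu 2%:E].

Definition L2dot dd (T : measurableType dd) (mu : {measure set T -> \bar R})
    (f g : T -> C) : C :=
  cint mu (fun t => f t * conjc (g t)).

Definition rv n (t : n.-tuple RT) : 'rV[R]_n := \row_i tnth t i.

Definition rint n (f : 'rV[R]_n -> R) : R := \int[leb n]_t f (rv t).

Definition cintv n (f : 'rV[R]_n -> C) : C := cint (leb n) (fun t => f (rv t)).

Definition L2v n : set ('rV[R]_n -> C) :=
  [set f | L2 (leb n) (fun t => f (rv t))].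

(* Functions of (x, v) are curried; R^{2d} carries the product measure. *)
Definition onR2d n (u : 'rV[R]_n -> 'rV[R]_n -> C)
    (z : n.-tuple RT * n.-tuple RT) : C := u (rv z.1) (rv z.2).

Definition leb2 n : {measure set (n.-tuple RT * n.-tuple RT) -> \bar R} :=
  (leb n \x leb n)%E.

(* [p] represents the orthogonal projection of [u] onto the (closed) subspace
   of L^2(R^{2d}) formed by the classes of the elements of [F]. *)
Definition orth_proj n (F : set ('rV[R]_n -> 'rV[R]_n -> C))
    (u p : 'rV[R]_n -> 'rV[R]_n -> C) : Prop :=
  [/\ L2 (leb2 n) (onR2d u), F p &
      forall q, F q ->
        L2dot (leb2 n) (onR2d (fun x v => u x v - p x v)) (onR2d q) = 0].

End integration.

Section operators.
Context {R : realType}.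
Local Notation C := R[i].
Local Notation toC := (real_complex R).

Definition muh n (h : R) (v : 'rV[R]_n) : R :=
  (2 * pi * h) `^ (- (n%:R / 4)) * expR (- (enorm v ^+ 2 / (4 * h))).

Definition muh_L2 n (h : R) : set ('rV[R]_n -> 'rV[R]_n -> C) :=
  [set f | exists2 rho, L2v rho & f = fun x v => toC (muh h v) * rho x].

(* [g] represents Q_h u, i.e. u is in L^2 and g is a representative of the
   class of h (u - Pi_h u). *)
Definition Qh n (h : R) (u g : 'rV[R]_n -> 'rV[R]_n -> C) : Prop :=
  exists2 p, orth_proj (muh_L2 h) u p &
    forall x v, g x v = toC h * (u x v - p x v).

Definition cpartial n (i : 'I_n) (f : 'rV[R]_n -> C) (v : 'rV[R]_n) : C :=
  Complex (partial i (fun w => complex.Re (f w)) v) (partial i (fun w => complex.Im (f w)) v).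

Definition bh n (h : R) (u : 'rV[R]_n -> C) (v : 'rV[R]_n) : 'rV[C]_n :=
  \row_i (toC h * cpartial i u v + toC (v 0 i / 2) * u v).

Definition cis (t : R) : C := Complex (cos t) (sin t).

Definition Oph n (h : R) (a : 'rV[R]_n -> 'rV[R]_n -> C)
    (u : 'rV[R]_n -> C) (v : 'rV[R]_n) : C :=
  toC ((2 * pi * h) ^- n) *
  cintv (fun eta => cintv (fun v' =>
    cis (dotp (v - v') eta / h) * a (2^-1 *: (v + v')) eta * u v')).

Definition Oph_mx n k (h : R) (a : 'rV[R]_n -> 'rV[R]_n -> 'M[C]_k)
    (u : 'rV[R]_n -> 'rV[C]_k) (v : 'rV[R]_n) : 'rV[C]_k :=
  \row_i \sum_j Oph h (fun w eta => a w eta i j) (fun w => u w 0 j) v.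

Definition msym n (y h : R) (v eta : 'rV[R]_n) : R :=
  2 * (y + 1) `^ (n%:R - 2) *
  expR (- (y / h * (enorm v ^+ 2 / 2 + 2 * enorm eta ^+ 2))).

End operators.

Section quasimode.
Context {R : realType} (n : nat).
Implicit Types (V : 'rV[R]_n -> R) (s lx lv x v : 'rV[R]_n) (h y : R).

Definition W V x v : R := V x / 2 + enorm v ^+ 2 / 4.

Definition ell s lx lv x v : R := dotp lx (x - s) + dotp lv v.

Definition theta s lx lv h x v : R :=
  oint 0 (ell s lx lv x v) (fun t => expR (- (t ^+ 2 / (2 * h)))).

Definition phi V s lx lv h x v : R :=
  theta s lx lv h x v * expR (- (W V x v / h)).

Definition Lden lv y : R := Num.sqrt (4 * y * enorm lv ^+ 2 + (y + 1) ^+ 2).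

Definition Lform s lx lv y x v : R :=
  ((1 + y) * dotp lx (x - s) + (1 - y) * dotp lv v) / Lden lv y.

Definition Lvec lx lv y : 'rV[R]_(n + n) :=
  row_mx (((1 + y) / Lden lv y) *: lx) (((1 - y) / Lden lv y) *: lv).

Lemma LformE s lx lv y x v :
  Lform s lx lv y x v = dotp (Lvec lx lv y) (row_mx (x - s) v).
Proof.
rewrite /Lform; move: (x - s) => z; rewrite mulrDl /dotp big_split_ord /= !(mulrAC _ _ (Lden lv y)^-1).
congr (_ + _); rewrite mulr_sumr; apply: eq_bigr => i _.
  by rewrite !row_mxEl mxE mulrA.
by rewrite !row_mxEr mxE mulrA.
Qed.

(* The integral over [0, 1] of the R^{2d}-valued function
   d_y(L_y) exp(-(W + L_y(x,v)^2 / 2) / h), taken componentwise. *)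
Definition Lint V s lx lv h x v : 'rV[R]_(n + n) :=
  \row_k \int[lebesgue_measure]_(y in `[0, 1])
    (derive1 (fun t : R => Lvec lx lv t) y 0 k *
     expR (- ((W V x v + Lform s lx lv y x v ^+ 2 / 2) / h))).

Definition Qphi V s lx lv h x v : R :=
  - h * dotp (Lint V s lx lv h x v) (row_mx (x - s) v).

Definition Opbphi_coef V s lx lv h y x v : R :=
  2 * h * (2 * pi * h) `^ (- (n%:R / 2)) * expR (- (V x / (2 * h))) *
  ((y + 1) `^ (n%:R - 2) / (4 * y) `^ (n%:R / 2)) *
  rint (fun v' => expR (- (h^-1 *
    (enorm v' ^+ 2 / 4 + y / 8 * enorm (v + v') ^+ 2 +
     enorm (v - v') ^+ 2 / (8 * y) + ell s lx lv x v' ^+ 2 / 2)))).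

End quasimode.

(* Main.v *)
Require Import Defs.
From HB Require Import structures.
From mathcomp Require Import all_boot all_order all_algebra.
From mathcomp Require Import all_classical all_reals all_analysis.
From mathcomp.real_closed Require Import complex.
From mathcomp Require Import measurable_realfun ring lra.
Import Order.TTheory GRing.Theory Num.Theory.
Import numFieldNormedType.Exports.
Local Open Scope classical_set_scope.
Local Open Scope ring_scope.

(** Write G(a) for the integral of exp (- s^2 / (2h)) over [0, a] ([gprim h]
below), so that phi = G(ell) exp (- W / h).

The formula for Q_h phi.  The scalar product of d_y L_y with (x - s, v) is the
y-derivative of L_y(x, v), hence the integrand of the statement is
exp (- W / h) times the y-derivative of G(L_y(x, v)), and the integral is
exp (- W / h) (G(L_1) - G(L_0)) ([dotp_Lint]).  Now L_0 = ell, while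
L_1 = lx.(x - s) / (1 + |lv|^2)^(1/2) does not depend on v.  So
phi - Q_h phi / h = exp (- W / h) G(L_1) is mu_h(v) times a function of x, and
it remains to see that it is the projection of phi: for each x, the Gaussian
average over v of G(lx.(x - s) + lv.v) is G(L_1).  This is the statement that
convolving an error function with a Gaussian only changes its width
([Rintegral_gprim_affine]), applied to one coordinate of v after the other
([Rintegral_ridge], [Rintegral_gprim_ridge], [fiber_orthogonal]).

That phi and its projection are square integrable needs exp (- V / h) to be
integrable.  Since V is bounded below and |grad V| >= 1/C away from a ball, V
grows at least linearly ([linear_growth]).

The Weyl operator.  In b_h phi the terms in which the Gaussian weight is
differentiated cancel against v / 2, so b_h phi = h exp (- (ell^2 / 2 + W) / h) lv
([bh_phi]).  Everything in Op_h(m) b_h phi is then dominated by a product of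
Gaussians in eta and v', the order of integration may be exchanged, and the
integral over eta is the Fourier transform of a Gaussian
([Rintegral_cos_gauss], [Rintegral_cos_ridge], [weyl_integral]). *)

(** * Gaussian integrals on the real line *)

Section one_variable.
Context {R : realType}.
Local Notation mu := (@lebesgue_measure R).
Implicit Types (f F : R -> R) (a b c h m t v w p : R).

Lemma continuous_integrable_itv f a b : continuous f ->
  mu.-integrable `[a, b] (EFin \o f).
Proof.
move=> cf; apply: continuous_compact_integrable; first exact: segment_compact.
exact: continuous_subspaceT.
Qed.

(** Moving the base point to a common left end [M] removes the case distinction
in the oriented integral, so that the usual theorem on primitives applies. *)
Lemma oint_sub f M a : continuous f -> M <= 0 -> M <= a ->
  oint 0 a f = \int[mu]_(t in `[M, a]) f t - \int[mu]_(t in `[M, 0]) f t.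
Proof.
move=> cf M0 Ma.
have key x y : M <= x -> x <= y -> \int[mu]_(t in `[M, y]) f t -
    \int[mu]_(t in `[M, x]) f t = \int[mu]_(t in `[x, y]) f t.
  move=> Mx xy; rewrite Rintegral_itvB ?bnd_simp//; last first.
    exact: continuous_integrable_itv.
  rewrite Rintegral_itv_obnd_cbnd//.
  apply: integrableS (continuous_integrable_itv f x y cf) => //.
  exact: subset_itv_oc_cc.
rewrite /oint; case: ifPn => [a0|]; first by rewrite key.
by rewrite -ltNge => /ltW a0; rewrite -(key a 0)// opprB.
Qed.

Lemma is_derive_oint f a : continuous f ->
  is_derive a (1 : R) (fun x => oint 0 x f) (f a).
Proof.
move=> cf; pose M := Num.min 0 a - 1.
have Ma : M < a by rewrite /M ltrBlDr (@le_lt_trans _ _ a)// ?ge_min ?lexx ?orbT// ltrDl.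
have M0 : M < 0 by rewrite /M ltrBlDr (@le_lt_trans _ _ 0)// ?ge_min ?lexx// ltrDl.
have aa1 : a < a + 1 by rewrite ltrDl.
have [dF F'] := continuous_FTC1_closed aa1
  (continuous_integrable_itv f M (a + 1) cf) Ma (cf a).
apply: (@near_eq_is_derive _ _ _
  (fun x => \int[mu]_(t in `[M, x]) f t - \int[mu]_(t in `[M, 0]) f t)).
  near=> x; rewrite (@oint_sub f M)// ?(ltW M0)//.
  by apply: ltW; near: x; apply: lt_nbhsr.
have H : is_derive a (1 : R) (fun x => \int[mu]_(t in `[M, x]) f t) (f a).
  by split; [exact: dF|rewrite -derive1E].
by rewrite -[f a]subr0; exact: is_deriveB.
Unshelve. all: by end_near. Qed.

Lemma continuous_oint f : continuous f -> continuous (fun x => oint 0 x f).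
Proof.
move=> cf x; apply/differentiable_continuous/derivable1_diffP.
by have [] := is_derive_oint f x cf.
Qed.

(** The first parameter is a variance.  The weight is left unnormalized, like
the Gaussian factors of exp (- W / h) and of the Weyl symbol. *)
Definition gauss v t : R := expR (- (t ^+ 2 / (2 * v))).

Lemma gauss_gt0 v t : 0 < gauss v t. Proof. exact: expR_gt0. Qed.

Lemma gauss_le1 v t : 0 < v -> gauss v t <= 1.
Proof.
move=> v0; rewrite -[1]expR0 ler_expR oppr_le0 divr_ge0 ?sqr_ge0//.
by rewrite mulr_ge0// ltW.
Qed.

#[global] Instance is_derive_gauss v t :
  is_derive t (1 : R) (gauss v) (- (t / v) * gauss v t).
Proof.
rewrite /gauss; apply: trigger_derive; rewrite /GRing.scale/=.
by rewrite invfM; move: (v^-1) (expR _) => i e; field.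
Qed.

Lemma continuous_gauss v : continuous (gauss v).
Proof.
move=> x; apply/differentiable_continuous/derivable1_diffP.
by have [] := is_derive_gauss v x.
Qed.

Lemma normal_pdf_gauss v m t : 0 < v ->
  normal_pdf m (Num.sqrt v) t = normal_peak (Num.sqrt v) * gauss v (t - m).
Proof.
move=> v0; rewrite /normal_pdf gt_eqF ?sqrtr_gt0//; congr (_ * _).
by rewrite /gauss /normal_fun sqr_sqrtr ?ltW// mulNr -(mulr_natl v 2).
Qed.

Lemma integrable_gauss v m : 0 < v ->
  mu.-integrable setT (fun t => (gauss v (t - m))%:E).
Proof.
move=> v0; have p0 : normal_peak (Num.sqrt v) != 0.
  by rewrite gt_eqF// normal_peak_gt0// gt_eqF// sqrtr_gt0.
have := @integrable_normal_pdf R m (Num.sqrt v).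
move=> /(integrableZl measurableT (normal_peak (Num.sqrt v))^-1).
congr (integrable _ _ _); apply/funext => t /=.
by rewrite normal_pdf_gauss// -EFinM mulrA mulVf// mul1r.
Qed.

Lemma Rintegral_gauss v m : 0 < v ->
  \int[mu]_t gauss v (t - m) = Num.sqrt (2 * pi * v).
Proof.
move=> v0; have p0 : normal_peak (Num.sqrt v) != 0.
  by rewrite gt_eqF// normal_peak_gt0// gt_eqF// sqrtr_gt0.
have := @integral_normal_pdf R m (Num.sqrt v).
under eq_integral do rewrite normal_pdf_gauss//.
move=> /(congr1 fine); rewrite -[LHS]/(\int[mu]_x (_ * _)).
rewrite RintegralZl//; last exact: integrable_gauss.
move=> /(congr1 ( *%R (normal_peak (Num.sqrt v))^-1)).
rewrite mulrA mulVf// mul1r mulr1 => ->.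
rewrite /normal_peak invrK sqr_sqrtr ?ltW// -mulr_natl.
by congr Num.sqrt; ring.
Qed.

Lemma integrable_gauss0 v : 0 < v -> mu.-integrable setT (EFin \o gauss v).
Proof.
move=> v0; have := integrable_gauss v 0 v0.
by congr (integrable _ _ _); apply/funext => t /=; rewrite subr0.
Qed.

Lemma Rintegral_gauss0 v : 0 < v -> \int[mu]_t gauss v t = Num.sqrt (2 * pi * v).
Proof.
move=> v0; rewrite -(Rintegral_gauss v 0 v0).
by apply: eq_Rintegral => t _; rewrite subr0.
Qed.

(** Differentiation under the integral sign, packaged for a domination which is
uniform in the parameter. *)
Lemma is_derive_Rintegral dd (T : measurableType dd)
    (nu : {measure set T -> \bar R}) (f df : R -> T -> R) (G : T -> R) a :
  (forall x, nu.-integrable setT (EFin \o f x)) ->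
  (forall x y, is_derive x (1 : R) (f ^~ y) (df x y)) ->
  nu.-integrable setT (EFin \o G) ->
  (forall x y, `|df x y| <= G y) ->
  is_derive a (1 : R) (fun x => \int[nu]_y f x y) (\int[nu]_y df a y).
Proof.
move=> fi fd Gi dG.
have aI : `]a - 1, a + 1[%classic a by rewrite /= in_itv/= ltrBlDr ltrDl ltr01.
have G0 y : 0 <= G y by rewrite (le_trans _ (dG a y)).
have E x y : partial1of2 f x y = df x y.
  by rewrite partial1of2E; have [_ ->] := fd x y.
have dv x y : derivable (f ^~ y) x 1 by have [] := fd x y.
have dGE x y : `|partial1of2 f x y| <= G y by rewrite E.
split.
  by apply: (@derivable_under_integral _ _ _ nu f setT measurableT
    a (a - 1) (a + 1) aI _ _ G).
rewrite -derive1E (@differentiation_under_integral _ _ _ nu f setT measurableT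
    a (a - 1) (a + 1) aI _ _ G)//.
by apply: eq_Rintegral => y _; rewrite E.
Qed.

(** The integrals over [-n, n] are F(n) - F(- n); dominated convergence does the
rest.  This is what integration by parts on the whole line amounts to here. *)
Lemma Rintegral_derive0 F f :
  (forall t, is_derive t (1 : R) F (f t)) -> continuous f ->
  mu.-integrable setT (EFin \o f) ->
  F t @[t --> +oo] --> (0 : R) -> F t @[t --> -oo] --> (0 : R) ->
  \int[mu]_t f t = 0.
Proof.
move=> dF cf fi Fy FNy.
pose g n t := (f \_ `[- (n.+1%:R), n.+1%:R]) t.
have gE n : (\int[mu]_t (g n t)%:E = (F n.+1%:R - F (- n.+1%:R))%:E)%E.
  transitivity (\int[mu]_t (EFin \o g n) t)%E => //.
  rewrite -restrict_EFin -integral_mkcond EFinB; apply: continuous_FTC2.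
  - by rewrite -subr_gt0 opprK addr_gt0.
  - exact: continuous_subspaceT.
  - have cF x : {for x, continuous F}.
      apply/differentiable_continuous/derivable1_diffP.
      by have [] := dF x.
    split.
    + by move=> x _; have [] := dF x.
    + by apply: cvg_at_right_filter; exact: cF.
    + by apply: cvg_at_left_filter; exact: cF.
  - by move=> x _; rewrite derive1E; have [_ ->] := dF x.
have mf : measurable_fun setT f by exact: continuous_measurable_fun.
have : (\int[mu]_t (g n t)%:E)%E @[n --> \oo] --> (\int[mu]_t (f t)%:E)%E.
  apply: (@dominated_cvg _ _ _ mu setT measurableT _ _
    (fun t => `|f t|%:E)) => //.
  - move=> n; apply/measurable_EFinP.
    apply: (measurable_restrictT f (measurable_itv `[- (n.+1%:R), n.+1%:R])).1.
    exact: measurable_funTS.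
  - move=> t _; apply: cvg_near_cst.
    exists (Num.truncn `|t|) => // n /= tn; congr EFin; rewrite /g patchE mem_set//=.
    rewrite in_itv/= -ler_norml (le_trans (ltW (truncnS_gt _)))//.
    by rewrite ler_nat ltnS.
  - exact: integrable_norm.
  - move=> n t _; rewrite lee_fin /g patchE; case: ifPn => // _.
    by rewrite normr0.
under eq_cvg do rewrite gE.
have : (F n.+1%:R - F (- n.+1%:R))%:E @[n --> \oo] --> (0 : R)%:E.
  apply: cvg_EFin; first exact: nearW.
  rewrite -[0 : R]subr0; apply: cvgB.
    apply: (cvg_comp (fun n : nat => n.+1%:R : R) F _ Fy).
    by rewrite (cvg_shiftS (fun n : nat => n%:R : R)); exact: cvgr_idn.
  apply: (cvg_comp (fun n : nat => - n.+1%:R : R) F _ FNy).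
  rewrite (cvg_shiftS (fun n : nat => - (n%:R : R))).
  by apply/cvgNrNy; exact: cvgr_idn.
move=> /[swap] /cvg_unique /[apply] /= E.
by rewrite /Rintegral E.
Qed.

Lemma Rintegral_odd f : measurable_fun setT f -> (forall t, f (- t) = - f t) ->
  mu.-integrable setT (EFin \o f) -> \int[mu]_t f t = 0.
Proof.
move=> mf fN fi.
have NfE : (EFin \o f) \o -%R = EFin \o (fun t => - f t).
  by apply/funext => t /=; rewrite fN.
have Nfi : mu.-integrable setT ((EFin \o f) \o -%R).
  by rewrite NfE; have := integrableN fi.
have E : \int[mu]_t f t = \int[mu]_t (- f t).
  congr fine; transitivity
    (\int[pushforward mu (-%R : R -> measurableTypeR R)]_t (f t)%:E)%E.
    apply: eq_measure_integral => A mA _; apply/esym; exact: lebesgue_measureN.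
  rewrite integral_pushforward//.
  - by apply: eq_integral => t _ /=; rewrite fN.
  - exact/measurable_EFinP.
have : \int[mu]_t f t = - \int[mu]_t f t.
  rewrite {1}E -mulN1r -RintegralZl//.
  by apply: eq_Rintegral => t _; rewrite mulN1r.
by move/eqP; rewrite -addr_eq0 -mulr2n mulrn_eq0 => /eqP.
Qed.

Lemma gaussN v t : gauss v (- t) = gauss v t.
Proof. by rewrite /gauss sqrrN. Qed.

Lemma gauss_cvgy v : 0 < v -> gauss v t @[t --> +oo] --> (0 : R).
Proof.
move=> v0; apply: (cvg_comp (fun t => t ^+ 2 / (2 * v)) (fun t => expR (- t))).
  apply: gt0_cvgMly; first by rewrite invr_gt0 mulr_gt0.
  exact: cvgr_expr2.
exact: cvgr_expR.
Qed.

Lemma gauss_cvgNy v : 0 < v -> gauss v t @[t --> -oo] --> (0 : R).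
Proof.
move=> v0; apply/cvgNy_compNP => /=.
by under eq_cvg do rewrite gaussN; exact: gauss_cvgy.
Qed.

Lemma le_integrableR dd (T : measurableType dd) (nu : {measure set T -> \bar R})
    (f g : T -> R) :
  measurable_fun setT f -> (forall x, `|f x| <= g x) ->
  nu.-integrable setT (EFin \o g) -> nu.-integrable setT (EFin \o f).
Proof.
move=> mf fg; apply: le_integrable => //; first exact/measurable_EFinP.
by move=> x _ /=; rewrite lee_fin (le_trans (fg x))// ler_norm.
Qed.

(** The polynomial factor is absorbed by half of the Gaussian. *)
Lemma integrable_moment v : 0 < v ->
  mu.-integrable setT (EFin \o (fun t => `|t| * gauss v t)).
Proof.
move=> v0; apply: (@le_integrableR _ _ mu _
    (fun t => (1 + 4 * v) * gauss (2 * v) t)).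
- apply: measurable_funM; first exact: normr_measurable.
  by apply: continuous_measurable_fun; exact: continuous_gauss.
- move=> t; rewrite normrM normr_id (ger0_norm (ltW (gauss_gt0 _ _))).
  have -> : gauss v t = gauss (2 * v) t * gauss (2 * v) t.
    rewrite /gauss -expRD; congr expR; field; exact: lt0r_neq0.
  rewrite mulrA ler_wpM2r ?(ltW (gauss_gt0 _ _))//.
  rewrite {1}/gauss expRN ler_pdivrMr ?expR_gt0//.
  have := expR_ge1Dx (t ^+ 2 / (2 * (2 * v))).
  set x := _ / _; have -> : x = t ^+ 2 / (4 * v) by rewrite /x; congr (_ / _); ring.
  move=> H; apply: (@le_trans _ _ ((1 + 4 * v) * (1 + t ^+ 2 / (4 * v)))).
    have -> : (1 + 4 * v) * (1 + t ^+ 2 / (4 * v)) =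
        1 + 4 * v + t ^+ 2 / (4 * v) + t ^+ 2.
      by field; exact: lt0r_neq0.
    have : 0 <= t ^+ 2 / (4 * v) by rewrite divr_ge0 ?sqr_ge0// mulr_ge0// ltW.
    (* 2 |t| <= 1 + t^2 *)
    have := real_normK (num_real t); have := sqr_ge0 (`|t| - 1).
    by rewrite sqrrB1; nra.
  by rewrite ler_wpM2l// addr_ge0// mulr_ge0// ltW.
- have := integrable_gauss0 (2 * v) (mulr_gt0 (ltr0Sn _ 1) v0).
  by move=> /(integrableZl measurableT (1 + 4 * v)).
Qed.

Definition gprim v a := oint 0 a (gauss v).

#[global] Instance is_derive_gprim v a : is_derive a (1 : R) (gprim v) (gauss v a).
Proof. exact: (is_derive_oint _ a (continuous_gauss v)). Qed.

(* Otherwise the search for derivatives unfolds both functions to exponentials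
and integrals, and does not use the two instances above. *)
#[global] Typeclasses Opaque gauss gprim.

Lemma continuous_gprim v : continuous (gprim v).
Proof. exact: continuous_oint (continuous_gauss v). Qed.

Lemma gprim0 v : gprim v 0 = 0.
Proof. by rewrite /gprim /oint lexx set_itv1 Rintegral_set1. Qed.

Lemma gprimN v a : gprim v (- a) = - gprim v a.
Proof.
have : gprim v (- a) + gprim v a = gprim v (- 0) + gprim v 0.
  apply: (@is_derive_0_is_cst _ (fun a => gprim v (- a) + gprim v a)) => x.
  by apply: trigger_derive; rewrite gaussN mulrN1 addNr.
by rewrite oppr0 gprim0 addr0 => /eqP; rewrite addr_eq0 => /eqP.
Qed.

Lemma gprim_bound v a : 0 < v -> `|gprim v a| <= Num.sqrt (2 * pi * v).
Proof.
move=> v0; wlog a0 : a / 0 <= a.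
  by move=> H; have [/H//|/ltW a0] := leP 0 a; rewrite -normrN -gprimN H// oppr_ge0.
have gi := integrable_gauss0 v v0.
rewrite -(Rintegral_gauss0 v v0) /gprim /oint a0 ger0_norm; last first.
  by apply: Rintegral_ge0 => t _; exact/ltW/gauss_gt0.
rewrite Rintegral_mkcond; apply: le_Rintegral => //.
  rewrite -restrict_EFin; apply/integrable_restrict => //=; rewrite ?setTI//.
  by apply: integrableS gi.
by move=> t _; rewrite patchE; case: ifPn => // _; exact/ltW/gauss_gt0.
Qed.

Lemma measurable_gauss v : measurable_fun [set: measurableTypeR R] (gauss v).
Proof. by apply: continuous_measurable_fun; exact: continuous_gauss. Qed.

Lemma integrable_gauss_mul v (f : R -> R) B : 0 < v ->
  measurable_fun [set: measurableTypeR R] f ->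
  (forall t, `|f t| <= B) -> mu.-integrable setT (EFin \o (fun t => f t * gauss v t)).
Proof.
move=> v0 mf fB; apply: (@le_integrableR _ _ mu _ (fun t => B * gauss v t)).
- by apply: measurable_funM => //; exact: measurable_gauss.
- move=> t; rewrite normrM (ger0_norm (ltW (gauss_gt0 _ _))).
  by rewrite ler_wpM2r// ltW// gauss_gt0.
- have := integrableZl measurableT B (integrable_gauss0 v v0).
  by [].
Qed.

(** Completing the square: with D = 1 + c^2 b^2, the product of the two weights
is a Gaussian of variance h / D centred at [m], times a factor free of [t]. *)
Lemma Rintegral_gauss_affine h a b c : 0 < h ->
  \int[mu]_t (gauss h (c * (a + b * t)) * gauss h t) =
  Num.sqrt (2 * pi * h) / Num.sqrt (1 + c ^+ 2 * b ^+ 2) *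
    gauss h (c / Num.sqrt (1 + c ^+ 2 * b ^+ 2) * a).
Proof.
move=> h0; set D := 1 + _.
have D0 : 0 < D by rewrite ltr_pwDl// mulr_ge0 ?sqr_ge0.
pose m := - (c ^+ 2 * a * b / D).
have E t : gauss h (c * (a + b * t)) * gauss h t =
    gauss h (c / Num.sqrt D * a) * gauss (h / D) (t - m).
  rewrite /gauss -!expRD; congr expR; rewrite -!opprD; congr (- _).
  rewrite !exprMn exprVn sqr_sqrtr ?(ltW D0)// /m.
  have := lt0r_neq0 D0; rewrite /D => Dn0; field.
  by rewrite exprMn Dn0 lt0r_neq0.
under eq_Rintegral do rewrite E.
rewrite RintegralZl//; last exact: (integrable_gauss (h / D) m (divr_gt0 h0 D0)).
rewrite (Rintegral_gauss (h / D) m (divr_gt0 h0 D0)) mulrC; congr (_ * _).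
rewrite mulrA sqrtrM ?sqrtrV// ?(ltW D0)//.
by rewrite mulr_ge0 ?(ltW h0)// mulr_ge0// ltW// pi_gt0.
Qed.

(** Both sides vanish at a = 0, where the integrand is odd in [t], and they have
the same derivative in [a] by [Rintegral_gauss_affine].  In units of h,
the variance 1 / c^2 of the error function and the variance b^2 of the average
add up. *)
Lemma Rintegral_gprim_affine h a b c : 0 < h ->
  \int[mu]_t (gprim h (c * (a + b * t)) * gauss h t) =
  Num.sqrt (2 * pi * h) * gprim h (c / Num.sqrt (1 + c ^+ 2 * b ^+ 2) * a).
Proof.
move=> h0; set r := c / _; set K := Num.sqrt (2 * pi * h).
pose I a := \int[mu]_t (gprim h (c * (a + b * t)) * gauss h t).
have mg x : measurable_fun [set: measurableTypeR R] (fun t => gprim h (c * (x + b * t))).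
  apply: measurableT_comp.
    by apply: continuous_measurable_fun; exact: continuous_gprim.
  by apply: measurable_funM => //; apply: measurable_funD => //; exact: measurable_funM.
have fi x : mu.-integrable setT (EFin \o (fun t => gprim h (c * (x + b * t)) * gauss h t)).
  apply: (@integrable_gauss_mul h _ K h0 (mg x)) => t.
  exact: gprim_bound.
have dI x : is_derive x (1 : R) I (K * (gauss h (r * x) * r)).
  rewrite [X in is_derive _ _ _ X](_ : _ =
    \int[mu]_t (c * (gauss h (c * (x + b * t)) * gauss h t))).
    apply: (@is_derive_Rintegral _ _ mu
      (fun x t => gprim h (c * (x + b * t)) * gauss h t)
      (fun x t => c * (gauss h (c * (x + b * t)) * gauss h t))
      (fun t => `|c| * gauss h t)).
    - exact: fi.
    - move=> y t; apply: trigger_derive; rewrite /GRing.scale/=; ring.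
    - have := integrableZl measurableT `|c| (integrable_gauss0 h h0); by [].
    - move=> y t; rewrite !normrM ler_wpM2l//.
      rewrite !(ger0_norm (ltW (gauss_gt0 _ _))) -[leRHS]mul1r.
      by rewrite ler_wpM2r ?gauss_le1// ltW// gauss_gt0.
  rewrite RintegralZl//; last first.
    apply: (@integrable_gauss_mul h _ 1 h0).
      apply: measurableT_comp; first exact: measurable_gauss.
      by apply: measurable_funM => //; apply: measurable_funD => //; exact: measurable_funM.
    by move=> t; rewrite ger0_norm ?gauss_le1// ltW// gauss_gt0.
  by rewrite Rintegral_gauss_affine// -/r -/K /r; ring.
have I0 : I 0 = 0.
  apply: (@Rintegral_odd (fun t => gprim h (c * (0 + b * t)) * gauss h t)) => //.
    exact: (measurable_funM (mg 0) (measurable_gauss h)).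
  by move=> t; rewrite gaussN !add0r !mulrN gprimN mulNr.
have : I a - K * gprim h (r * a) = I 0 - K * gprim h (r * 0).
  apply: (@is_derive_0_is_cst _ (fun a => I a - K * gprim h (r * a))) => x.
  have := dI x => ?.
  by apply: trigger_derive; rewrite /GRing.scale/=; ring.
by rewrite I0 mulr0 gprim0 mulr0 subrr => /eqP; rewrite subr_eq0 => /eqP.
Qed.

(** The Fourier transform of a Gaussian: as functions of [w], both sides solve
u' = - v w u.  The phase [p] gives the cosine and the sine transform at once,
and is preserved when several variables are integrated one after the other. *)
Lemma Rintegral_cos_gauss v p w : 0 < v ->
  \int[mu]_t (cos (p + w * t) * gauss v t) =
  cos p * (Num.sqrt (2 * pi * v) * expR (- (v * w ^+ 2 / 2))).
Proof.
move=> v0; pose I w := \int[mu]_t (cos (p + w * t) * gauss v t).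
have mL x : measurable_fun [set: measurableTypeR R] (fun t => p + x * t).
  by apply: measurable_funD => //; exact: measurable_funM.
have mcos x : measurable_fun [set: measurableTypeR R] (fun t => cos (p + x * t)).
  apply: measurableT_comp (mL x); apply: continuous_measurable_fun.
  exact: continuous_cos.
have msin x : measurable_fun [set: measurableTypeR R] (fun t => sin (p + x * t)).
  apply: measurableT_comp (mL x); apply: continuous_measurable_fun.
  exact: continuous_sin.
have fi x : mu.-integrable setT (EFin \o (fun t => cos (p + x * t) * gauss v t)).
  by apply: (@integrable_gauss_mul v _ 1 v0 (mcos x)) => t; rewrite ler_norml cos_geN1 cos_le1.
have dfi x : mu.-integrable setT (EFin \o (fun t => - t * sin (p + x * t) * gauss v t)).
  apply: (@le_integrableR _ _ mu _ (fun t => `|t| * gauss v t)).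
  - apply: measurable_funM; last exact: measurable_gauss.
    by apply: measurable_funM => //; exact: oppr_measurable.
  - move=> t; rewrite !normrM normrN (ger0_norm (ltW (gauss_gt0 _ _))).
    rewrite ler_wpM2r ?(ltW (gauss_gt0 _ _))// -[leRHS]mulr1 ler_wpM2l//.
    by rewrite ler_norml sin_geN1 sin_le1.
  - exact: integrable_moment.
have dI x : is_derive x (1 : R) I (- (v * x) * I x).
  rewrite [X in is_derive _ _ _ X](_ : _ = \int[mu]_t (- t * sin (p + x * t) * gauss v t)).
    apply: (@is_derive_Rintegral _ _ mu
      (fun x t => cos (p + x * t) * gauss v t)
      (fun x t => - t * sin (p + x * t) * gauss v t)
      (fun t => `|t| * gauss v t)).
    - exact: fi.
    - move=> y t; apply: trigger_derive; rewrite /GRing.scale/=; ring.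
    - exact: integrable_moment.
    - move=> y t; rewrite !normrM normrN (ger0_norm (ltW (gauss_gt0 _ _))).
      rewrite ler_wpM2r ?(ltW (gauss_gt0 _ _))// -[leRHS]mulr1 ler_wpM2l//.
      by rewrite ler_norml sin_geN1 sin_le1.
  have sq (A : set_system R) : Filter A -> gauss v t @[t --> A] --> (0 : R) ->
      sin (p + x * t) * gauss v t @[t --> A] --> (0 : R).
    move=> FA gA; apply: norm_cvg0; apply: (squeeze_cvgr _ (cvg_cst 0) gA).
    apply: nearW => t; rewrite normr_ge0/= normrM (ger0_norm (ltW (gauss_gt0 _ _))).
    by rewrite ler_piMl ?(ltW (gauss_gt0 _ _))// ler_norml sin_geN1 sin_le1.
  (* the integrand is the derivative of sin (p + x t) gauss v t *)
  have : \int[mu]_t (x * (cos (p + x * t) * gauss v t) +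
      v^-1 * (- t * sin (p + x * t) * gauss v t)) = 0.
    apply: (@Rintegral_derive0 (fun t => sin (p + x * t) * gauss v t)).
    - by move=> t; apply: trigger_derive; rewrite /GRing.scale/=; ring.
    - move=> t; apply/differentiable_continuous/derivable1_diffP.
      exact: ex_derive.
    - have := integrableD measurableT (integrableZl measurableT x (fi x))
        (integrableZl measurableT v^-1 (dfi x)); by [].
    - by apply: sq; exact: gauss_cvgy.
    - by apply: sq; exact: gauss_cvgNy.
  rewrite RintegralD//.
  - rewrite !RintegralZl// => /eqP; rewrite addr_eq0 => /eqP E.
    by rewrite mulNr -mulrA [x * _]E mulrN opprK mulrA mulfV ?lt0r_neq0// mul1r.
  - by have := integrableZl measurableT x (fi x).
  - by have := integrableZl measurableT v^-1 (dfi x).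
have I0 : I 0 = cos p * Num.sqrt (2 * pi * v).
  rewrite /I -Rintegral_gauss0// -RintegralZl//; last exact: integrable_gauss0.
  by apply: eq_Rintegral => t _; rewrite mul0r addr0.
have : I w * expR (v * w ^+ 2 / 2) = I 0 * expR (v * 0 ^+ 2 / 2).
  apply: (@is_derive_0_is_cst _ (fun w => I w * expR (v * w ^+ 2 / 2))) => x.
  have := dI x => ?.
  by apply: trigger_derive; rewrite /GRing.scale/=; field.
rewrite expr0n/= mulr0 mul0r expR0 mulr1 I0 => E.
by rewrite -/(I w) mulrA -E -[RHS]mulrA expRxMexpNx_1 mulr1.
Qed.

End one_variable.

(** * Integration on R^n by iterated integrals *)

Section products.
Context {R : realType} d1 d2 (T1 : measurableType d1) (T2 : measurableType d2).
Variables (m1 : {sigma_finite_measure set T1 -> \bar R})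
          (m2 : {sigma_finite_measure set T2 -> \bar R}).

(** In an iterated real-valued integral, inner integrals that are infinite are
replaced by 0; by Fubini they only occur on a negligible set. *)
Lemma ae_fineK d (T : measurableType d) (m : {measure set T -> \bar R})
    (F : T -> \bar R) :
  measurable_fun setT F -> {ae m, forall x, F x \is a fin_num} ->
  (\int[m]_x (fine (F x))%:E)%E = (\int[m]_x F x)%E.
Proof.
move=> mF Ffin; apply: ae_eq_integral => //.
  by apply/measurable_EFinP; apply: measurableT_comp.
by apply: filterS Ffin => x Fx _; rewrite fineK.
Qed.

Lemma Rintegral12_prod (f : T1 * T2 -> R) :
  (m1 \x m2)%E.-integrable setT (EFin \o f) ->
  \int[(m1 \x m2)%E]_z f z = \int[m1]_x \int[m2]_y f (x, y).
Proof.
move=> fi; rewrite {1}/Rintegral -integral12_prod_meas1//.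
rewrite -ae_fineK//; first exact: (measurable_fubini_F fi).
by apply: filterS (ae_integrable1 fi) => x; exact: integrable_fin_num.
Qed.

Lemma Rintegral21_prod (f : T1 * T2 -> R) :
  (m1 \x m2)%E.-integrable setT (EFin \o f) ->
  \int[(m1 \x m2)%E]_z f z = \int[m2]_y \int[m1]_x f (x, y).
Proof.
move=> fi; rewrite {1}/Rintegral -integral21_prod_meas1//.
rewrite -ae_fineK//; first exact: (measurable_fubini_G fi).
by apply: filterS (ae_integrable2 fi) => x; exact: integrable_fin_num.
Qed.

Lemma integrable_prod (f : T1 -> R) (g : T2 -> R) :
  m1.-integrable setT (EFin \o f) -> m2.-integrable setT (EFin \o g) ->
  (m1 \x m2)%E.-integrable setT (EFin \o (fun z => f z.1 * g z.2)).
Proof.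
move=> fi gi.
have mf : measurable_fun setT f by apply/measurable_EFinP; exact: (measurable_int m1).
have mg : measurable_fun setT g by apply/measurable_EFinP; exact: (measurable_int m2).
apply/integrable12ltyP.
  apply/measurable_EFinP; apply: measurable_funM.
    by apply: measurableT_comp mf _; exact: measurable_fst.
  by apply: measurableT_comp mg _; exact: measurable_snd.
rewrite [X in (X < _)%E](_ : _ =
    (\int[m1]_x (`|(f x)%:E| * (\int[m2]_y `|(g y)%:E|)))%E); last first.
  apply: eq_integral => x _; rewrite -ge0_integralZl//.
    by apply: eq_integral => y _ /=; rewrite -EFinM -normrM.
  by apply: measurableT_comp => //; exact/measurable_EFinP.
rewrite ge0_integralZr//.
- apply: lte_mul_pinfty; first exact: integral_ge0.
    by have := integrable_fin_num measurableT (integrable_abse fi).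
  by have /integrableP[_] := gi.
- by apply: measurableT_comp => //; exact/measurable_EFinP.
- exact: integral_ge0.
Qed.

End products.

Section lebesgue_n.
Context {R : realType}.
Local Notation RT := (measurableTypeR R).
Local Notation mu := (@lebesgue_measure R).

Lemma integrable_leb0 (f : 0.-tuple RT -> R) : (leb 0).-integrable setT (EFin \o f).
Proof.
have mf : measurable_fun setT f.
  rewrite (_ : f = cst (f [tuple])) => //.
  by apply/funext => t /=; congr f; exact: tuple0.
apply/integrableP; split; first exact/measurable_EFinP.
rewrite integral_dirac//=; first by rewrite diracT mul1e ltry.
by apply/measurable_EFinP; exact: measurableT_comp.
Qed.

Lemma Rintegral_leb0 (f : 0.-tuple RT -> R) : \int[leb 0]_t f t = f [tuple].
Proof.
have /integrableP[mf _] := integrable_leb0 f.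
by rewrite /Rintegral (integral_dirac _ measurableT mf) diracT mul1e.
Qed.

Lemma integral_leb_cons n (f : n.+1.-tuple RT -> \bar R) :
  (\int[leb n.+1]_t f t = \int[pushforward (mu \x leb n) (@tcons R n)]_t f t)%E.
Proof. by apply: eq_measure_integral => //; exact: measurable_tcons. Qed.

Lemma integrable_leb_cons n (f : n.+1.-tuple RT -> R) : measurable_fun setT f ->
  (mu \x leb n)%E.-integrable setT (EFin \o (f \o @tcons R n)) ->
  (leb n.+1).-integrable setT (EFin \o f).
Proof.
move=> mf fi.
have := @integrable_pushforward _ _ _ _ _ _ (@measurable_tcons R n)
  (mu \x leb n)%E setT (EFin \o f).
rewrite preimage_setT => /(_ _ fi measurableT).
move=> /(_ _)/integrableP[|mF]; first exact/measurable_EFinP.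
rewrite -integral_leb_cons => Foo; apply/integrableP; split => //.
Qed.

Lemma Rintegral_leb_cons n (f : n.+1.-tuple RT -> R) : measurable_fun setT f ->
  (mu \x leb n)%E.-integrable setT (EFin \o (f \o @tcons R n)) ->
  \int[leb n.+1]_t f t = \int[leb n]_t \int[mu]_x f (tcons (x, t)).
Proof.
move=> mf fi; rewrite -(Rintegral21_prod _ _ _ _ _ _ _ fi).
congr fine; rewrite integral_leb_cons (integral_pushforward (@measurable_tcons R n))//.
  exact/measurable_EFinP.
Qed.

(** Weights of product form split along the recursive definition of [leb]. *)
Definition tensor n (g : R -> R) (t : n.-tuple RT) : R := \prod_(i < n) g (tnth t i).

Lemma measurable_tensor n (g : R -> R) : measurable_fun [set: RT] g ->
  measurable_fun setT (@tensor n g).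
Proof.
move=> mg; apply: measurable_prod => i _.
by apply: (measurableT_comp mg); exact: measurable_tnth.
Qed.

Lemma tensor_cons n g x (t : n.-tuple RT) :
  tensor n.+1 g (tcons (x, t)) = g x * tensor n g t.
Proof.
rewrite /tensor big_ord_recl; congr (_ * _).
by apply: eq_bigr => i _; rewrite /tcons/= tnthS.
Qed.

Lemma integrable_tensor n (g : R -> R) : mu.-integrable setT (EFin \o g) ->
  (leb n).-integrable setT (EFin \o tensor n g).
Proof.
move=> gi; have mg : measurable_fun [set: RT] g.
  by apply/measurable_EFinP; exact: (measurable_int mu).
elim: n => [|n IH]; first exact: integrable_leb0.
apply: integrable_leb_cons; first exact: measurable_tensor.
rewrite (_ : _ \o _ = fun z => g z.1 * tensor n g z.2).
  exact: integrable_prod.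
by apply/funext => -[x t] /=; rewrite tensor_cons.
Qed.

Lemma measurable_linear n (b : 'I_n -> R) :
  measurable_fun setT (fun t : n.-tuple RT => \sum_(i < n) b i * tnth t i).
Proof.
apply: measurable_sum => i; apply: measurable_funM => //.
exact: measurable_tnth.
Qed.

(** A function of a single linear form is integrated against a product weight
one coordinate at a time: [F k] is what remains of [F 0] after [k] coordinates. *)
Lemma Rintegral_ridge n (g : R -> R) (F : nat -> R -> R) (B : nat -> R)
    (b : 'I_n -> R) a :
  (forall t, 0 <= g t) -> mu.-integrable setT (EFin \o g) ->
  (forall k, measurable_fun [set: RT] (F k)) -> (forall k x, `|F k x| <= B k) ->
  (forall (k : 'I_n) x, \int[mu]_t (F k (x + b k * t) * g t) = F k.+1 x) ->
  \int[leb n]_t (F 0 (a + \sum_(i < n) b i * tnth t i) * tensor n g t) = F n a.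
Proof.
move=> g0 gi; have mg : measurable_fun [set: RT] g.
  by apply/measurable_EFinP; exact: (measurable_int mu).
elim: n F B b a => [|n IH] F B b a mF FB FE.
  by rewrite Rintegral_leb0 big_ord0 /tensor big_ord0 addr0 mulr1.
pose f (t : n.+1.-tuple RT) := F 0 (a + \sum_(i < n.+1) b i * tnth t i) * tensor n.+1 g t.
have mf : measurable_fun setT f.
  apply: measurable_funM; last exact: measurable_tensor.
  apply: (measurableT_comp (mF 0%N)); apply: measurable_funD => //.
  exact: measurable_linear.
have gpos m t : 0 <= tensor m g t by apply: prodr_ge0.
have B0 : 0 <= B 0%N by rewrite (le_trans _ (FB 0%N a)).
have fi : (mu \x leb n)%E.-integrable setT (EFin \o (f \o @tcons R n)).
  apply: (@le_integrableR _ _ _ (mu \x leb n)%E _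
      (fun z => B 0%N * (g z.1 * tensor n g z.2))).
  - by apply: (measurableT_comp mf); exact: measurable_tcons.
  - move=> [x t]; rewrite /f/= tensor_cons normrM (ger0_norm (mulr_ge0 _ _))//.
    by rewrite ler_wpM2r// mulr_ge0.
  - have := integrableZl measurableT (B 0%N)
      (integrable_prod _ _ _ _ mu (leb n) _ _ gi (integrable_tensor n g gi)).
    by [].
rewrite -/f Rintegral_leb_cons//.
rewrite -[RHS](IH (fun k => F k.+1) (fun k => B k.+1) (fun i => b (lift ord0 i)) a)//.
  apply: eq_Rintegral => t _; rewrite -(FE ord0) -RintegralZr//.
    apply: eq_Rintegral => x _; rewrite /f tensor_cons big_ord_recl/= !mulrA.
    congr (F _ _ * _ * _); rewrite -addrA [X in _ + X]addrC; congr (_ + (_ + _)).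
    by apply: eq_bigr => i _; rewrite tnthS.
  apply: (@le_integrableR _ _ _ mu _ (fun x => B 0%N * g x)).
  - apply: measurable_funM => //; apply: (measurableT_comp (mF 0%N)).
    by apply: measurable_funD => //; exact: measurable_funM.
  - by move=> x; rewrite normrM (ger0_norm (g0 x)) ler_wpM2r.
  - by have := integrableZl measurableT (B 0%N) gi.
by move=> k x; exact: (FE (lift ord0 k) x).
Qed.

(** A continuous function is the limit of its values at the points of the grid
(Z/k)^n, which depend on countably many measurable events only. *)
Lemma measurable_continuous_rv n (f : 'rV[R]_n -> R) : continuous f ->
  measurable_fun setT (fun t : n.-tuple RT => f (rv t)).
Proof.
move=> cf.
pose q (k : nat) (z : n.-tuple int) : 'rV[R]_n :=
  \row_i ((tnth z i)%:~R / k.+1%:R).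
pose cell (k : nat) (t : n.-tuple RT) : n.-tuple int :=
  [tuple of map (fun x : R => Num.floor (x * k.+1%:R)) t].
apply: (@measurable_fun_cvg _ _ _ _ (fun k t => f (q k (cell k t)))).
  move=> k _ Y mY; rewrite setTI.
  rewrite (_ : _ @^-1` _ = \bigcup_(z : n.-tuple int)
      ([set t | Y (f (q k z)) /\ forall i, Num.floor (tnth t i * k.+1%:R) = tnth z i])); last first.
    apply/seteqP; split => t /=.
      by move=> Yt; exists (cell k t) => //=; split => // i; rewrite tnth_map.
    move=> [z _ /= [Yz tz]]; rewrite (_ : cell k t = z)//.
    by apply: eq_from_tnth => i; rewrite tnth_map.
  apply: countable_bigcupT_measurable => [|z]; first exact: countableP.
  have [Yz|nYz] := pselect (Y (f (q k z))); last first.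
    by rewrite (_ : [set t | _] = set0)//; apply/seteqP; split => t //= [].
  rewrite (_ : [set t | _] = \bigcap_(i in [set: 'I_n])
      ((fun t : n.-tuple RT => tnth t i) @^-1`
        `[(tnth z i)%:~R / k.+1%:R, (tnth z i + 1)%:~R / k.+1%:R[)).
    apply: fin_bigcap_measurable => [|i _]; first exact: finite_finset.
    by rewrite -[X in measurable X]setTI; apply: measurable_tnth.
  have floorE (x : R) (m : int) : (Num.floor (x * k.+1%:R) = m) <->
      x \in `[m%:~R / k.+1%:R, (m + 1)%:~R / k.+1%:R[.
    rewrite in_itv/= ler_pdivrMr// ltr_pdivlMr//; split => [<-|].
      by rewrite floor_itv.
    by move=> /floor_def.
  apply/seteqP; split => t /=.
    by move=> [_ tz] i _; apply/floorE.
  by move=> tz; split => // i; apply/floorE; exact: tz.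
move=> t _; apply: (cvg_comp _ f _ (cf (rv t))).
apply/cvg_ballP => e e0; near=> k; split => // i j; rewrite ord1 !mxE tnth_map /ball/=.
have k0 : 0 < k.+1%:R :> R by [].
have /andP[h1 h2] := floor_itv (tnth t j * k.+1%:R).
rewrite ger0_norm; last by rewrite subr_ge0 ler_pdivrMr.
have -> : tnth t j - (Num.floor (tnth t j * k.+1%:R))%:~R / k.+1%:R =
    (tnth t j * k.+1%:R - (Num.floor (tnth t j * k.+1%:R))%:~R) / k.+1%:R.
  by field; rewrite lt0r_neq0.
rewrite ltr_pdivrMr//; apply: (@lt_trans _ _ 1).
  by rewrite ltrBlDl; move: h2; rewrite intrD.
rewrite -ltr_pdivrMl// mulr1 (@lt_trans _ _ k%:R)// ?ltr_nat//.
by near: k; exact: nbhs_infty_gtr.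
Unshelve. all: by end_near. Qed.

End lebesgue_n.

(** * Linear growth of the potential *)

Section growth.
Context {R : realType}.
Local Notation RT := (measurableTypeR R).
Local Notation mu := (@lebesgue_measure R).

Lemma dotp_ge0 n (u : 'rV[R]_n) : 0 <= dotp u u.
Proof. by apply: sumr_ge0 => i _; rewrite -expr2 sqr_ge0. Qed.

Lemma enorm_ge0 n (u : 'rV[R]_n) : 0 <= enorm u.
Proof. exact: sqrtr_ge0. Qed.

Lemma enorm_sqr n (u : 'rV[R]_n) : enorm u ^+ 2 = dotp u u.
Proof. by rewrite sqr_sqrtr// dotp_ge0. Qed.

Lemma le_coord_norm n (u : 'rV[R]_n) i : `|u 0 i| <= `|u|.
Proof.
rewrite [leRHS]/Num.norm/= mx_normrE.
by apply: (le_trans _ (le_bigmax _ _ (0, i))).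
Qed.

Lemma norm_le_enorm n (u : 'rV[R]_n) : `|u| <= enorm u.
Proof.
rewrite [leLHS]/Num.norm/=; have [->|/mx_norm_neq0[[k i] ->/=]] := eqVneq (mx_norm u) 0.
  exact: enorm_ge0.
rewrite (ord1 k) -sqrtr_sqr ler_wsqrtr// /dotp (bigD1 i)//= expr2 lerDl.
by apply: sumr_ge0 => j _; rewrite -expr2 sqr_ge0.
Qed.

Lemma derive_grad n (f : 'rV[R]_n -> R) x w : differentiable f x ->
  'D_w f x = dotp (grad f x) w.
Proof.
move=> df; rewrite deriveE// {1}(row_sum_delta w) linear_sum/=.
apply: eq_bigr => i _; rewrite linearZ/= /grad mxE /partial deriveE//.
by rewrite mulrC.
Qed.

(** Ekeland's argument: a minimizer [y] of V + e |. - x| satisfies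
|grad V y| <= e, hence, as e < 1 / C, lies in the ball of radius [C]; and
V x >= V y + e |y - x|.  The penalty is the sup norm, which is compared with the
Euclidean norm of the gradient by [norm_le_enorm]. *)
Lemma linear_growth n (V : 'rV[R]_n -> R) (m C : R) :
  (forall x, differentiable V x) -> (forall x, m <= V x) -> 0 < C ->
  (forall x, C < enorm x -> C^-1 <= enorm (grad V x)) ->
  forall x, m + (2 * C)^-1 * (`|x| - C) <= V x.
Proof.
have ineq (a b e N N0 W t : R) :
    a + e * N0 <= b + e * N -> e * N <= e * (t * W + N0) -> t * - (e * W) <= b - a.
  by lra.
move=> dV mV C0 gV x; set e := (2 * C)^-1.
have e0 : 0 < e by rewrite invr_gt0 mulr_gt0.
pose f y := V y + e * `|y - x|.
have cV : continuous V by move=> y; exact/differentiable_continuous.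
have cN : continuous (fun y : 'rV[R]_n => `|y - x|).
  move=> y; apply: (@continuous_comp _ _ _ (fun y : 'rV[R]_n => y - x) Num.norm).
    apply: (@continuousB _ _ _ id (cst x)); first exact: (@cvg_id _ (nbhs y)).
    exact: cst_continuous.
  exact: norm_continuous.
have cf : continuous f.
  move=> y; apply: (@continuousD _ _ _ V (fun y => e * `|y - x|)); first exact: cV.
  apply: (@continuousM _ _ (cst e) (fun y : 'rV[R]_n => `|y - x|)); last exact: cN.
  exact: cst_continuous.
pose r := (V x - m) / e + 1.
have r0 : 0 <= r by rewrite addr_ge0// divr_ge0 ?(ltW e0)// subr_ge0.
pose A : set 'rV[R]_n := [set y | `|y - x| <= r].
have cA : compact A.
  apply: bounded_closed_compact.
    exists (`|x| + r); split; first exact: num_real.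
    move=> M xM y /= Ay; rewrite -(subrK x y) (le_trans (ler_normD _ _))//.
    by rewrite addrC (le_trans _ (ltW xM))// lerD2l.
  apply: (@closed_comp _ _ (fun y : 'rV[R]_n => `|y - x|) [set z : R | z <= r]).
    by move=> y _; exact: cN.
  exact: closed_le.
have Ax : A x by rewrite /A/= subrr normr0.
have [y0 _ y0min] : exists2 c, c \in A & forall t, t \in A -> f c <= f t.
  apply: EVT_min_rV => //; first by exists x.
  exact: continuous_subspaceT.
have fx : f x = V x by rewrite /f subrr normr0 mulr0 addr0.
(* [r] is so large that f > f x outside the ball: the minimum is global. *)
have ymin y : f y0 <= f y.
  have [Ay|nAy] := pselect (A y); first by apply: y0min; rewrite inE.
  apply: (@le_trans _ _ (f x)); first by apply: y0min; rewrite inE.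
  rewrite fx /f -lerBlDl; apply: (@le_trans _ _ (V x - m)); first by rewrite lerB.
  move/negP: nAy; rewrite /A/= -ltNge => /ltW.
  rewrite -(ler_pM2l e0); apply: le_trans.
  by rewrite /r mulrDr mulrCA mulfV ?mulr1 ?lt0r_neq0// lerDl ltW.
pose w := grad V y0.
(* the one-sided derivative of f at its minimizer, in the direction - w *)
have wle : dotp w w <= e * `|w|.
  have : - (e * `|w|) <= 'D_(- w) V y0.
    have dd : derivable V y0 (- w) by exact: diff_derivable.
    apply: (cvgr_to_ge (cvg_dnbhs_at_right dd)).
    near=> t; have t0 : 0 < t by near: t; exact: nbhs_right_gt.
    rewrite -(ler_pM2l t0) /GRing.scale/= mulrA mulfV ?lt0r_neq0// mul1r.
    apply: (ineq _ _ _ _ _ _ _ (ymin (t *: - w + y0))).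
    rewrite ler_pM2l// -addrA (le_trans (ler_normD _ _))// lerD2r normrZ normrN.
    by rewrite (gtr0_norm t0).
  rewrite derive_grad// -/w => H; rewrite -lerN2 (le_trans H)//.
  rewrite (_ : dotp w (- w) = - dotp w w)//.
  by rewrite /dotp -sumrN; apply: eq_bigr => i _; rewrite [(- w) 0 i]mxE mulrN.
have y0C : `|y0| <= C.
  apply: (le_trans (norm_le_enorm _ y0)); rewrite leNgt; apply/negP => /gV.
  rewrite -/w => Cw.
  have w0 : 0 < enorm w by rewrite (lt_le_trans _ Cw)// invr_gt0.
  have : enorm w <= e.
    rewrite -(ler_pM2r w0) -expr2 enorm_sqr (le_trans wle)//.
    by rewrite ler_pM2l// norm_le_enorm.
  move/(le_trans Cw); rewrite lef_pV2 ?posrE ?mulr_gt0//.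
  by lra.
have := ymin x; rewrite fx => /(le_trans _); apply; rewrite /f lerD// ler_pM2l//.
rewrite distrC (le_trans _ (lerB_dist _ _))// lerD2l lerN2//.
Unshelve. all: by end_near. Qed.

Lemma integrable_exp_abs (c : R) : 0 < c ->
  mu.-integrable setT (EFin \o (fun x => expR (- (c * `|x|)))).
Proof.
move=> c0; have cE : continuous (fun x : R => expR (- (c * `|x|))).
  move=> x; apply: (@continuous_comp _ _ _ (fun x : R => - (c * `|x|)) expR);
    last exact: continuous_expR.
  apply: cvgN; apply: cvgM; first exact: cvg_cst.
  exact: norm_continuous.
have mE : measurable_fun [set: RT] (fun x : R => expR (- (c * `|x|))).
  exact: continuous_measurable_fun.
apply/integrableP; split; first exact/measurable_EFinP.
under eq_integral do rewrite /= ger0_norm ?expR_ge0//.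
rewrite ge0_symfun_integralT//; last by move=> x /=; rewrite normrN.
rewrite lte_mul_pinfty//.
apply: (@le_lt_trans _ _ (c^-1%:E * \int[mu]_x (exponential_pdf c x)%:E)%E).
  rewrite -ge0_integralZl//; last 3 first.
  - by apply/measurable_EFinP; exact: measurable_exponential_pdf.
  - by move=> x _; rewrite lee_fin exponential_pdf_ge0// ltW.
  - by rewrite lee_fin invr_ge0 ltW.
  rewrite -set_itvcy [leLHS]integral_mkcond.
  apply: (ge0_le_integral mu measurableT).
  - by move=> x _; rewrite patchE; case: ifPn => // _; rewrite lee_fin expR_ge0.
  - apply/(measurable_restrictT _ _).1; first exact: measurable_itv.
    by apply/measurable_EFinP; exact: measurable_funTS.
  - apply/measurable_EFinP; apply: measurable_funM => //.
    exact: measurable_exponential_pdf.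
  - move=> x _; rewrite patchE; case: ifPn => [|_]; last first.
      by rewrite -EFinM lee_fin mulr_ge0 ?exponential_pdf_ge0 ?invr_ge0// ltW.
    rewrite inE/= in_itv/= andbT => x0; rewrite exponential_pdfE// -EFinM lee_fin.
    by rewrite ger0_norm// mulrA mulVf ?lt0r_neq0// mul1r mulNr.
by rewrite integral_exponential_pdf// mule1 ltry.
Qed.

(** The sup norm dominates the mean of the |x_i|, which turns the bound into one
by a product of functions of one variable. *)
Lemma integrable_exp_growth n (V : 'rV[R]_n -> R) (a e h : R) :
  continuous V -> 0 < h -> 0 < e -> (forall x, a + e * `|x| <= V x) ->
  (leb n).-integrable setT (EFin \o (fun t : n.-tuple RT => expR (- (V (rv t) / h)))).
Proof.
move=> cV h0 e0 Vge; pose c := e / h / n.+1%:R.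
have c0 : 0 < c by rewrite !divr_gt0.
apply: (@le_integrableR _ _ _ (leb n) _
  (fun t => expR (- (a / h)) * tensor n (fun x => expR (- (c * `|x|))) t)).
- apply: (measurable_continuous_rv n (fun x => expR (- (V x / h)))) => x.
  apply: (@continuous_comp _ _ _ (fun x => - (V x / h)) expR); last exact: continuous_expR.
  apply: (@continuousN _ _ _ (fun x => V x / h)).
  apply: (@continuousM _ _ V (cst h^-1)); first exact: cV.
  exact: cst_continuous.
- move=> t; rewrite ger0_norm ?expR_ge0// /tensor -expR_sum -expRD ler_expR.
  rewrite sumrN -opprD lerN2 -mulr_sumr.
  apply: (@le_trans _ _ ((a + e * `|rv t : 'rV[R]_n|) / h)); last first.
    by rewrite ler_pM2r ?invr_gt0.
  rewrite mulrDl lerD2l /c -!mulrA ler_pM2l// [leRHS]mulrC ler_pM2l ?invr_gt0//.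
  rewrite mulrC ler_pdivrMr//.
  apply: (@le_trans _ _ (\sum_(i < n) `|rv t : 'rV[R]_n|)).
    by apply: ler_sum => i _; rewrite (le_trans _ (le_coord_norm _ _ i))// mxE.
  rewrite sumr_const card_ord -[leLHS]mulr_natr; rewrite ler_wpM2l//.
  by rewrite ler_nat.
- have := integrableZl measurableT (expR (- (a / h)))
    (integrable_tensor n _ (integrable_exp_abs _ c0)).
  by [].
Qed.

End growth.

(** * The integral over y as an integral of a derivative *)

Section quasimode_formula.
Context {R : realType} (n : nat).
Local Notation RT := (measurableTypeR R).
Local Notation mu := (@lebesgue_measure R).
Implicit Types (V : 'rV[R]_n -> R) (s lx lv x v : 'rV[R]_n) (h y : R).

Lemma Lden_gt0 lv y : 0 <= y -> 0 < Lden lv y.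
Proof.
move=> y0; rewrite sqrtr_gt0 ltr_wpDl//.
  by rewrite !mulr_ge0 ?enorm_ge0 ?exprn_ge0.
by rewrite exprn_gt0// ltr_wpDl.
Qed.

Lemma is_derive_Lden lv y : 0 <= y ->
  is_derive y (1 : R) (Lden lv) ((2 * enorm lv ^+ 2 + (y + 1)) / Lden lv y).
Proof.
move=> y0; have := Lden_gt0 lv y y0; rewrite sqrtr_gt0 => /is_derive1_sqrt H.
have S0 : Lden lv y != 0 by rewrite gt_eqF// Lden_gt0.
apply: trigger_derive; rewrite /GRing.scale/= -/(Lden lv y).
by field.
Qed.

Definition dcoefx lv y : R := (Lden lv y)^-1 -
  (1 + y) * (2 * enorm lv ^+ 2 + (y + 1)) * (Lden lv y)^-1 ^+ 3.

Definition dcoefv lv y : R := - (Lden lv y)^-1 -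
  (1 - y) * (2 * enorm lv ^+ 2 + (y + 1)) * (Lden lv y)^-1 ^+ 3.

Lemma is_derive_coefx lv y : 0 <= y ->
  is_derive y (1 : R) (fun t => (1 + t) / Lden lv t) (dcoefx lv y).
Proof.
move=> y0; have H := is_derive_Lden lv y y0.
have S0 : Lden lv y != 0 by rewrite gt_eqF// Lden_gt0.
apply: trigger_derive; rewrite /GRing.scale/= /dcoefx; by field.
Qed.

Lemma is_derive_coefv lv y : 0 <= y ->
  is_derive y (1 : R) (fun t => (1 - t) / Lden lv t) (dcoefv lv y).
Proof.
move=> y0; have H := is_derive_Lden lv y y0.
have S0 : Lden lv y != 0 by rewrite gt_eqF// Lden_gt0.
apply: trigger_derive; rewrite /GRing.scale/= /dcoefv; by field.
Qed.

Lemma derivable_Lden_inv lv y : 0 <= y ->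
  derivable (fun t => (Lden lv t)^-1) y 1.
Proof.
move=> y0; apply: derivableV; first by rewrite gt_eqF// Lden_gt0.
by have [] := is_derive_Lden lv y y0.
Qed.

Lemma derivable_dLx lv y : 0 <= y -> derivable (dcoefx lv) y 1.
Proof.
move=> /(derivable_Lden_inv lv)/derivableP.
have aux (j : R -> R) b dj : is_derive y (1 : R) j dj ->
    derivable (fun t => j t - (1 + t) * (b + (t + 1)) * j t ^+ 3) y 1.
  by move=> H; apply: ex_derive.
exact: aux.
Qed.

Lemma derivable_dLv lv y : 0 <= y -> derivable (dcoefv lv) y 1.
Proof.
move=> /(derivable_Lden_inv lv)/derivableP.
have aux (j : R -> R) b dj : is_derive y (1 : R) j dj ->
    derivable (fun t => - j t - (1 - t) * (b + (t + 1)) * j t ^+ 3) y 1.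
  by move=> H; apply: ex_derive.
exact: aux.
Qed.

Lemma derive1_Lvec lx lv y : 0 <= y ->
  derive1 (fun t : R => Lvec lx lv t) y =
  row_mx (dcoefx lv y *: lx) (dcoefv lv y *: lv).
Proof.
move=> y0; have Hx := is_derive_coefx lv y y0.
have Hv := is_derive_coefv lv y y0.
have E i j : is_derive y (1 : R) (fun t => Lvec lx lv t i j)
    (row_mx (dcoefx lv y *: lx) (dcoefv lv y *: lv) i j).
  rewrite (ord1 i); case: (split_ordP j) => k ->.
    rewrite row_mxEl mxE (_ : (fun _ => _) = fun t => (1 + t) / Lden lv t * lx 0 k).
      by apply: trigger_derive; rewrite /GRing.scale/=; ring.
    by apply/funext => t; rewrite /Lvec row_mxEl mxE.
  rewrite row_mxEr mxE (_ : (fun _ => _) = fun t => (1 - t) / Lden lv t * lv 0 k).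
    by apply: trigger_derive; rewrite /GRing.scale/=; ring.
  by apply/funext => t; rewrite /Lvec row_mxEr mxE.
rewrite derive1E derive_mx; last first.
  by apply/derivable_mxP => i j; have [] := E i j.
by apply/matrixP => i j; rewrite mxE; have [_ ->] := E i j.
Qed.

Lemma dotp_row_mx (a b c e : 'rV[R]_n) :
  dotp (row_mx a b) (row_mx c e) = dotp a c + dotp b e.
Proof.
rewrite /dotp big_split_ord/=; congr (_ + _); apply: eq_bigr => i _.
  by rewrite !row_mxEl.
by rewrite !row_mxEr.
Qed.

Lemma dotpZl (a : R) (u v : 'rV[R]_n) : dotp (a *: u) v = a * dotp u v.
Proof. by rewrite /dotp mulr_sumr; apply: eq_bigr => i _; rewrite mxE mulrA. Qed.

(** The integrand is exp (- W / h) times the derivative in [y] of G(L_y(x, v));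
L_0 = ell, and the coefficient of [v] in L_1 vanishes. *)
Lemma dotp_Lint V s lx lv h x v : 0 < h ->
  dotp (Lint V s lx lv h x v) (row_mx (x - s) v) =
  expR (- (W V x v / h)) *
    (gprim h (dotp lx (x - s) / Num.sqrt (1 + enorm lv ^+ 2)) -
     gprim h (ell s lx lv x v)).
Proof.
move=> h0; set z := x - s; set A := dotp lx z; set B := dotp lv v.
pose L t : R := (1 + t) / Lden lv t * A + (1 - t) / Lden lv t * B.
have LE t : Lform s lx lv t x v = L t by rewrite /Lform -/z -/A -/B /L; ring.
have dL y : 0 <= y -> is_derive y (1 : R) L (dcoefx lv y * A + dcoefv lv y * B).
  move=> y0; have Hx := is_derive_coefx lv y y0.
  have Hv := is_derive_coefv lv y y0.
  by apply: trigger_derive; rewrite /GRing.scale/=; ring.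
have S2 : Lden lv 1 = 2 * Num.sqrt (1 + enorm lv ^+ 2).
  rewrite /Lden -[X in X * Num.sqrt _](@ger0_norm _ 2)// -sqrtr_sqr -sqrtrM ?sqr_ge0//.
  by congr Num.sqrt; ring.
have S0 : Num.sqrt (1 + enorm lv ^+ 2) != 0.
  by rewrite gt_eqF// sqrtr_gt0 ltr_pwDl// exprn_ge0// enorm_ge0.
have L1 : L 1 = A / Num.sqrt (1 + enorm lv ^+ 2).
  by rewrite /L S2 subrr !mul0r addr0; field.
have L0 : L 0 = ell s lx lv x v.
  by rewrite /L /Lden !mulr0 !mul0r !add0r addr0 subr0 expr1n sqrtr1 divr1 !mul1r.
(* From here on only the derivative and the end values of [L] matter. *)
clearbody L.
pose E t := expR (- ((W V x v + L t ^+ 2 / 2) / h)).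
have EE t : E t = expR (- (W V x v / h)) * gauss h (L t).
  by rewrite /E /gauss -expRD; congr expR; field; exact: lt0r_neq0.
have cont01 (f : R -> R) : (forall y, 0 <= y -> derivable f y 1) ->
    {within `[0, 1], continuous f}.
  move=> df; apply: derivable_within_continuous => y.
  by rewrite in_itv/= => /andP[y0 _]; exact: df.
have int01 (f : R -> R) : (forall y, 0 <= y -> derivable f y 1) ->
    mu.-integrable `[0, 1] (EFin \o f).
  move=> df; apply: continuous_compact_integrable; first exact: segment_compact.
  exact: cont01.
have dg y : 0 <= y -> derivable (fun t => gauss h (L t)) y 1.
  move=> y0; have H := dL y y0.
  have [] := is_derive1_comp (is_derive_gauss h (L y)) H.
  by [].
have dE y : 0 <= y -> derivable E y 1.
  move=> y0; rewrite (funext EE); apply: (derivableM (f := cst _)); last exact: dg.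
  exact: derivable_cst.
have dP y : 0 <= y -> derivable (fun t => dcoefx lv t * E t) y 1.
  by move=> y0; apply: derivableM; [exact: derivable_dLx|exact: dE].
have dQ y : 0 <= y -> derivable (fun t => dcoefv lv t * E t) y 1.
  by move=> y0; apply: derivableM; [exact: derivable_dLv|exact: dE].
have dK y : 0 <= y ->
    derivable (fun t => gauss h (L t) * (dcoefx lv t * A + dcoefv lv t * B)) y 1.
  move=> y0; have H := dL y y0; apply: derivableM; first exact: dg.
  apply: derivableD; apply: derivableM => //;
    [exact: derivable_dLx|exact: derivable_dLv].
have PZ r : \int[mu]_(t in `[0, 1]) (dcoefx lv t * E t * r) =
    \int[mu]_(t in `[0, 1]) (dcoefx lv t * E t) * r.
  exact: (@RintegralZr _ _ _ mu _ _ r (measurable_itv `[0, 1]) (int01 _ dP)).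
have QZ r : \int[mu]_(t in `[0, 1]) (dcoefv lv t * E t * r) =
    \int[mu]_(t in `[0, 1]) (dcoefv lv t * E t) * r.
  exact: (@RintegralZr _ _ _ mu _ _ r (measurable_itv `[0, 1]) (int01 _ dQ)).
have -> : Lint V s lx lv h x v = row_mx
    ((\int[mu]_(y in `[0, 1]) (dcoefx lv y * E y)) *: lx)
    ((\int[mu]_(y in `[0, 1]) (dcoefv lv y * E y)) *: lv).
  apply/rowP => k; rewrite mxE.
  case: (split_ordP k) => i ->; rewrite ?row_mxEl ?row_mxEr mxE.
    rewrite -PZ.
    apply: eq_Rintegral => y; rewrite inE/= in_itv/= => /andP[y0 _].
    by rewrite derive1_Lvec// row_mxEl mxE LE -/(E y) mulrAC.
  rewrite -QZ.
  apply: eq_Rintegral => y; rewrite inE/= in_itv/= => /andP[y0 _].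
  by rewrite derive1_Lvec// row_mxEr mxE LE -/(E y) mulrAC.
rewrite dotp_row_mx !dotpZl -/A -/B.
have dG y : 0 <= y -> is_derive y (1 : R) (fun t => gprim h (L t))
    (gauss h (L y) * (dcoefx lv y * A + dcoefv lv y * B)).
  by move=> y0; have H := dL y y0; apply: trigger_derive; ring.
have c0 y (y0 : 0 <= y) : {for y, continuous (fun t => gprim h (L t))}.
  by apply/differentiable_continuous/derivable1_diffP; have [] := dG y y0.
have : \int[mu]_(y in `[0, 1]) (dcoefx lv y * E y * A + dcoefv lv y * E y * B) =
    expR (- (W V x v / h)) * (gprim h (L 1) - gprim h (L 0)).
  under eq_Rintegral do rewrite EE.
  rewrite (_ : (fun y => _) = fun y => expR (- (W V x v / h)) *
    (gauss h (L y) * (dcoefx lv y * A + dcoefv lv y * B))); last first.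
    by apply/funext => y; ring.
  rewrite RintegralZl//; last exact: int01.
  congr (_ * _); rewrite /Rintegral.
  rewrite (@continuous_FTC2 _ _ (fun t => gprim h (L t)))//.
  - exact: cont01.
  - split.
    + by move=> y; rewrite in_itv/= => /andP[/ltW y0 _]; have [] := dG y y0.
    + by apply: cvg_at_right_filter; exact: c0.
    + by apply: cvg_at_left_filter; exact: c0.
  - move=> y; rewrite in_itv/= => /andP[/ltW y0 _].
    by rewrite derive1E; have [_ ->] := dG y y0.
rewrite RintegralD//; last 2 first.
- by apply: int01 => y y0; apply: derivableM => //; exact: dP.
- by apply: int01 => y y0; apply: derivableM => //; exact: dQ.
rewrite PZ QZ.
by rewrite L1 L0.
Qed.

Lemma QphiE V s lx lv h x v : 0 < h ->
  Qphi V s lx lv h x v = h * (expR (- (W V x v / h)) *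
    (gprim h (ell s lx lv x v) -
     gprim h (dotp lx (x - s) / Num.sqrt (1 + enorm lv ^+ 2)))).
Proof. by move=> h0; rewrite /Qphi dotp_Lint// mulNr -mulrN -mulrN opprB. Qed.

Lemma phiE V s lx lv h x v :
  phi V s lx lv h x v = gprim h (ell s lx lv x v) * expR (- (W V x v / h)).
Proof. by []. Qed.

End quasimode_formula.

(** * Gaussian averages of functions of one linear form *)

Section gaussian_integrals.
Context {R : realType} (n : nat).
Local Notation RT := (measurableTypeR R).
Local Notation mu := (@lebesgue_measure R).
Implicit Types (a h p : R) (w : 'rV[R]_n).

Lemma measurable_dotp d (T : measurableType d) (f g : T -> 'rV[R]_n) :
  (forall i, measurable_fun setT (fun z => f z 0 i)) ->
  (forall i, measurable_fun setT (fun z => g z 0 i)) ->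
  measurable_fun setT (fun z => dotp (f z) (g z)).
Proof. by move=> mf mg; apply: measurable_sum => i; exact: measurable_funM. Qed.

Lemma measurable_rv i : measurable_fun setT (fun t : n.-tuple RT => rv t 0 i).
Proof.
rewrite (_ : (fun _ => _) = fun t : n.-tuple RT => tnth t i).
  exact: measurable_tnth.
by apply/funext => t; rewrite mxE.
Qed.

Lemma measurable_gprim h : measurable_fun [set: RT] (gprim h : R -> R).
Proof. by apply: continuous_measurable_fun; exact: continuous_gprim. Qed.

Lemma tensor_gauss h (t : n.-tuple RT) :
  tensor n (gauss h) t = gauss h (enorm (rv t)).
Proof.
rewrite /tensor -expR_sum; congr expR; rewrite sumrN; congr (- _).
rewrite -mulr_suml; congr (_ / _); rewrite enorm_sqr.
by apply: eq_bigr => i _; rewrite mxE expr2.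
Qed.

Lemma dotp_rv w (t : n.-tuple RT) : dotp w (rv t) = \sum_(i < n) w 0 i * tnth t i.
Proof. by apply: eq_bigr => i _; rewrite mxE. Qed.

Lemma sum_ltSn (F : 'I_n -> R) (k : 'I_n) :
  \sum_(i < n | (i < k.+1)%N) F i = \sum_(i < n | (i < k)%N) F i + F k.
Proof.
rewrite (bigD1 k) ?ltnS//= addrC; congr (_ + _); apply: eq_bigl => i.
by rewrite ltnS [RHS]ltn_neqAle andbC.
Qed.

Lemma prod_ltSn (F : 'I_n -> R) (k : 'I_n) :
  \prod_(i < n | (i < k.+1)%N) F i = \prod_(i < n | (i < k)%N) F i * F k.
Proof.
rewrite (bigD1 k) ?ltnS//= mulrC; congr (_ * _); apply: eq_bigl => i.
by rewrite ltnS [RHS]ltn_neqAle andbC.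
Qed.

(** The first [k] coordinates of [w] turn the width of the error function into
[D k] = 1 + w_0^2 + ... + w_(k-1)^2. *)
Lemma Rintegral_gprim_ridge h a w : 0 < h ->
  \int[leb n]_t (gprim h (a + dotp w (rv t)) * tensor n (gauss h) t) =
  Num.sqrt (2 * pi * h) ^+ n * gprim h (a / Num.sqrt (1 + enorm w ^+ 2)).
Proof.
move=> h0; set K := Num.sqrt (2 * pi * h).
pose D k := 1 + \sum_(i < n | (i < k)%N) w 0 i ^+ 2.
pose F k x := K ^+ k * gprim h ((Num.sqrt (D k))^-1 * x).
have D0 k : 0 < D k by rewrite ltr_pwDl// sumr_ge0// => i _; exact: sqr_ge0.
have D00 : D 0%N = 1 by rewrite /D big1 ?addr0.
have Dn : D n = 1 + enorm w ^+ 2.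
  rewrite /D enorm_sqr; congr (1 + _).
  by apply: eq_big => [i|i _]; rewrite ?ltn_ord// expr2.
under eq_Rintegral do rewrite dotp_rv.
have K0 : 0 <= K by exact: sqrtr_ge0.
rewrite -Dn [RHS](_ : _ = F n a); last by rewrite /F [a / _]mulrC.
rewrite -(@Rintegral_ridge R n (gauss h) F (fun k => K ^+ k * K) (fun i => w 0 i) a)//.
- by apply: eq_Rintegral => t _; rewrite /F D00 sqrtr1 invr1 mul1r expr0 mul1r.
- by move=> t; exact/ltW/gauss_gt0.
- exact: integrable_gauss0.
- move=> k; apply: measurable_funM => //; apply: measurableT_comp (measurable_gprim h) _.
  exact: measurable_funM.
- move=> k x; rewrite normrM (ger0_norm (exprn_ge0 _ K0)) ler_wpM2l ?exprn_ge0//.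
  exact: gprim_bound.
- move=> k x; rewrite /F; under eq_Rintegral do rewrite -mulrA.
  rewrite RintegralZl//; last first.
    apply: (@integrable_gauss_mul _ h _ K h0).
      apply: measurableT_comp (measurable_gprim h) _.
      by apply: measurable_funM => //; apply: measurable_funD => //; exact: measurable_funM.
    by move=> t; exact: gprim_bound.
  rewrite Rintegral_gprim_affine// -/K mulrA -exprSr; congr (_ * gprim h (_ * _)).
  rewrite exprVn sqr_sqrtr ?(ltW (D0 _))// -invfM -sqrtrM ?(ltW (D0 _))//.
  congr (Num.sqrt _)^-1; rewrite mulrDr mulr1 mulrA mulfV ?lt0r_neq0// mul1r.
  by rewrite /D sum_ltSn addrA.
Qed.

Lemma Rintegral_cos_ridge h p w : 0 < h ->
  \int[leb n]_t (cos (p + dotp w (rv t)) * tensor n (gauss h) t) =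
  cos p * (Num.sqrt (2 * pi * h) ^+ n * expR (- (h * enorm w ^+ 2 / 2))).
Proof.
move=> h0; set K := Num.sqrt (2 * pi * h).
pose c i := K * expR (- (h * w 0 i ^+ 2 / 2)).
pose F k x := (\prod_(i < n | (i < k)%N) c i) * cos x.
have c0 i : 0 <= c i by rewrite mulr_ge0 ?expR_ge0 ?sqrtr_ge0.
have P0 k : 0 <= \prod_(i < n | (i < k)%N) c i by apply: prodr_ge0.
have mcos : measurable_fun [set: RT] (cos : R -> R).
  by apply: continuous_measurable_fun; exact: continuous_cos.
under eq_Rintegral do rewrite dotp_rv.
rewrite [RHS](_ : _ = F n p); last first.
  rewrite /F mulrC; congr (_ * _).
  rewrite (eq_bigl predT) => [|i]; last exact: ltn_ord.
  rewrite big_split/= prodr_const card_ord; congr (_ * _).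
  rewrite -expR_sum; congr expR; rewrite sumrN -mulr_suml -mulr_sumr; congr (- (_ * _ / _)).
  by rewrite enorm_sqr; apply: eq_bigr => i _; rewrite expr2.
rewrite -(@Rintegral_ridge R n (gauss h) F (fun k => \prod_(i < n | (i < k)%N) c i)
  (fun i => w 0 i) p)//.
- by apply: eq_Rintegral => t _; rewrite /F [X in X * cos _]big_pred0 ?mul1r.
- by move=> t; exact/ltW/gauss_gt0.
- exact: integrable_gauss0.
- by move=> k; exact: measurable_funM.
- move=> k x; rewrite normrM (ger0_norm (P0 _)) -[leRHS]mulr1 ler_wpM2l//.
  by rewrite ler_norml cos_geN1 cos_le1.
- move=> k x; rewrite /F; under eq_Rintegral do rewrite -mulrA.
  rewrite RintegralZl//; last first.
    apply: (@integrable_gauss_mul _ h _ 1 h0).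
      apply: (measurableT_comp mcos).
      by apply: measurable_funD => //; exact: measurable_funM.
    by move=> t; rewrite ler_norml cos_geN1 cos_le1.
  by rewrite Rintegral_cos_gauss// -/K prod_ltSn /c; ring.
Qed.

Lemma Rintegral_tensor_gauss h : 0 < h ->
  \int[leb n]_t tensor n (gauss h) t = Num.sqrt (2 * pi * h) ^+ n.
Proof.
move=> h0; have := Rintegral_cos_ridge h 0 0 h0.
have E0 (u : 'rV[R]_n) : dotp 0 u = 0 by rewrite /dotp big1// => i _; rewrite mxE mul0r.
rewrite enorm_sqr E0 mulr0 mul0r oppr0 expR0 cos0 mulr1 mul1r => <-.
by apply: eq_Rintegral => t _; rewrite E0 addr0 cos0 mul1r.
Qed.

End gaussian_integrals.

(** * The Weyl operator applied to the twisted derivative of phi *)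

Section operator_formula.
Context {R : realType} (n : nat).
Local Notation RT := (measurableTypeR R).
Local Notation mu := (@lebesgue_measure R).
Local Notation toC := (real_complex R).
Implicit Types (V : 'rV[R]_n -> R) (s lx lv x v w : 'rV[R]_n) (h y p : R).

(** Reduces partial derivatives to derivatives of functions of one variable, for
which differentiation rules are found automatically. *)
Lemma partialE (f : 'rV[R]_n -> R) i v :
  partial i f v = 'D_(1 : R) (fun t : R => f (t *: delta_mx 0 i + v)) 0.
Proof.
rewrite /partial /derive; apply: (congr1 (fun F : R -> R => lim (F @ 0^'))).
by apply/funext => t /=; rewrite scale0r add0r /GRing.scale/= mulr1 addr0.
Qed.

Lemma dotp_delta lv i : dotp lv (delta_mx 0 i) = lv 0 i.
Proof.
rewrite /dotp (bigD1 i)//= mxE !eqxx mulr1 big1 ?addr0// => j /negbTE ji.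
by rewrite mxE eqxx ji mulr0.
Qed.

Lemma dotpDr (a b c : 'rV[R]_n) : dotp a (b + c) = dotp a b + dotp a c.
Proof. by rewrite /dotp -big_split; apply: eq_bigr => i _; rewrite mxE mulrDr. Qed.

Lemma dotpC (a b : 'rV[R]_n) : dotp a b = dotp b a.
Proof. by rewrite /dotp; apply: eq_bigr => i _; rewrite mulrC. Qed.

Lemma dotpZr (a : R) (u v : 'rV[R]_n) : dotp u (a *: v) = a * dotp u v.
Proof. by rewrite dotpC dotpZl dotpC. Qed.

(** Coefficient of [lv] in b_h phi. *)
Definition bphi V s lx lv h x v : R :=
  h * (gauss h (ell s lx lv x v) * expR (- (W V x v / h))).

Lemma is_derive_gprim_exp h (e l k N b : R) : h != 0 ->
  is_derive (0 : R) (1 : R) (fun t : R => gprim h (e + t * l) *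
    expR (- ((k + (N + 2 * t * b + t ^+ 2) / 4) / h)))
  ((gauss h e * l - gprim h e * (b / (2 * h))) * expR (- ((k + N / 4) / h))).
Proof.
move=> hn; apply: trigger_derive; rewrite /GRing.scale/=.
rewrite !mulr0 !mul0r !expr0n/= !addr0; field.
exact: hn.
Qed.

(** The derivative of the weight exp (- |v|^2 / (4h)) is compensated by v / 2:
only the derivative of theta survives. *)
Lemma partial_phi V s lx lv h x v i : 0 < h ->
  h * partial i (phi V s lx lv h x) v + v 0 i / 2 * phi V s lx lv h x v =
  bphi V s lx lv h x v * lv 0 i.
Proof.
move=> h0; have hn : h != 0 by rewrite gt_eqF.
pose N := enorm v ^+ 2.
rewrite partialE (_ : (fun t => _) = fun t => gprim h (ell s lx lv x v + t * lv 0 i) *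
    expR (- ((V x / 2 + (N + 2 * t * v 0 i + t ^+ 2) / 4) / h))); last first.
  apply/funext => t; rewrite phiE /W.
  congr (gprim h _ * expR (- ((_ + _ / _) / _))).
    by rewrite /ell [dotp lv (_ + _)]dotpDr dotpZr dotp_delta [t * _ + _]addrC addrA.
  rewrite /N !enorm_sqr !dotpDr ![dotp (_ + _) _]dotpC !dotpDr !dotpZl !dotpZr.
  rewrite dotp_delta mxE !eqxx mulr1 [dotp (delta_mx _ _) v]dotpC dotp_delta; ring.
rewrite (_ : 'D_(1 : R) _ 0 = (gauss h (ell s lx lv x v) * lv 0 i -
    gprim h (ell s lx lv x v) * (v 0 i / (2 * h))) * expR (- (W V x v / h))).
  by rewrite /bphi phiE; field.
by apply: derive_val; exact: is_derive_gprim_exp.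
Qed.

Lemma bh_phi V s lx lv h x : 0 < h ->
  bh h (fun w => toC (phi V s lx lv h x w)) =
  fun w => \row_i toC (bphi V s lx lv h x w * lv 0 i).
Proof.
move=> h0; apply/funext => w; apply/rowP => i; rewrite !mxE -partial_phi//.
rewrite /cpartial/= (_ : partial i (fun _ => 0) w = 0); last first.
  by rewrite /partial derive_cst.
by rewrite rmorphD !rmorphM.
Qed.

Lemma cosB_pihalf (t : R) : cos (- (pi / 2) + t) = sin t.
Proof. by rewrite cosD sinN cosN cos_pihalf sin_pihalf mul0r mulN1r opprK add0r. Qed.

(** The real and imaginary parts differ by the phase of the cosine only. *)
Lemma OphE (h : R) (m : 'rV[R]_n -> 'rV[R]_n -> R) (u : 'rV[R]_n -> R) v :
  Oph h (fun w eta => toC (m w eta)) (fun w => toC (u w)) v =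
  toC ((2 * pi * h) ^- n) *
  Complex
   (\int[leb n]_e \int[leb n]_t (cos (0 + dotp (v - rv t) (rv e) / h) *
      (m (2^-1 *: (v + rv t)) (rv e) * u (rv t))))
   (\int[leb n]_e \int[leb n]_t (cos (- (pi / 2) + dotp (v - rv t) (rv e) / h) *
      (m (2^-1 *: (v + rv t)) (rv e) * u (rv t)))).
Proof.
rewrite /Oph /cintv /cint.
apply: (congr1 (fun z => toC ((2 * pi * h) ^- n) * z)); apply: (@f_equal2 R R _ (@Complex R)).
  apply: eq_Rintegral => e _; apply: eq_Rintegral => t _ /=.
  by rewrite add0r !mulr0 !subr0 mulrA.
apply: eq_Rintegral => e _; apply: eq_Rintegral => t _ /=.
by rewrite cosB_pihalf !mulr0 !add0r mulrA.
Qed.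

Lemma measurable_enorm d (T : measurableType d) (f : T -> 'rV[R]_n) :
  (forall i, measurable_fun setT (fun z => f z 0 i)) ->
  measurable_fun setT (fun z => enorm (f z) ^+ 2).
Proof.
move=> mf; rewrite (_ : (fun _ => _) = fun z => dotp (f z) (f z)).
  exact: measurable_dotp.
by apply/funext => z; rewrite enorm_sqr.
Qed.

Lemma measurable_expRN d (T : measurableType d) (f : T -> R) :
  measurable_fun setT f -> measurable_fun setT (fun z => expR (- f z)).
Proof.
move=> mf; apply: (@measurableT_comp _ _ _ _ _ _ (fun r : R => expR (- r))) mf.
apply: continuous_measurable_fun => r.
apply: (@continuous_comp _ _ _ (fun r : R => - r) expR); last exact: continuous_expR.
exact: opp_continuous.
Qed.

Lemma measurable_enorm_affine (a c : R) v :
  measurable_fun setT (fun t : n.-tuple RT => enorm (a *: (v + c *: rv t)) ^+ 2).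
Proof.
apply: measurable_enorm => i.
rewrite (_ : (fun _ => _) = fun t : n.-tuple RT => a * (v 0 i + c * rv t 0 i)).
  apply: measurable_funM => //; apply: measurable_funD => //; apply: measurable_funM => //.
  exact: measurable_rv.
by apply/funext => t; rewrite !mxE.
Qed.

Lemma enormZ_sqr (a : R) (u : 'rV[R]_n) : enorm (a *: u) ^+ 2 = a ^+ 2 * enorm u ^+ 2.
Proof. by rewrite !enorm_sqr dotpZl dotpZr mulrA expr2. Qed.

Lemma tensor_gauss_ge0 a (t : n.-tuple RT) : 0 <= tensor n (gauss a) t.
Proof. by rewrite tensor_gauss ltW// gauss_gt0. Qed.

Lemma measurable_tensor_gauss a : measurable_fun setT (tensor n (gauss a) : _ -> R).
Proof. by apply: measurable_tensor; exact: measurable_gauss. Qed.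

Lemma integrable_tensor_gauss a : 0 < a ->
  (leb n).-integrable setT (EFin \o (tensor n (gauss a) : _ -> R)).
Proof. by move=> a0; apply: integrable_tensor; exact: integrable_gauss0. Qed.

Lemma measurable_cos_phase d (T : measurableType d) (f g : T -> 'rV[R]_n) v p h :
  (forall i, measurable_fun setT (fun z => f z 0 i)) ->
  (forall i, measurable_fun setT (fun z => g z 0 i)) ->
  measurable_fun setT (fun z => cos (p + dotp (v - f z) (g z) / h)).
Proof.
move=> mf mg; apply: (@measurableT_comp _ _ _ _ _ _ (cos : R -> R)).
  by apply: continuous_measurable_fun; exact: continuous_cos.
apply: measurable_funD => //; apply: measurable_funM => //.
apply: measurable_dotp => // i.
rewrite (_ : (fun _ => _) = fun z => v 0 i - f z 0 i); first exact: measurable_funB.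
by apply/funext => z; rewrite !mxE.
Qed.

(** Up to a constant, the integrand is a product of factors bounded by 1 and of
two Gaussian weights, in eta with variance h / (4y) and in v' with variance 2h;
so the integrals may be exchanged, and the one over eta is a Gaussian Fourier
transform. *)
Lemma weyl_integral V s lx lv x v h y p c : 0 < h -> 0 < y ->
  \int[leb n]_e \int[leb n]_t (cos (p + dotp (v - rv t) (rv e) / h) *
      (msym y h (2^-1 *: (v + rv t)) (rv e) * (bphi V s lx lv h x (rv t) * c))) =
  (2 * (y + 1) `^ (n%:R - 2) * h * expR (- (V x / (2 * h))) * c) * cos p *
  Num.sqrt (2 * pi * (h / (4 * y))) ^+ n *
  rint (fun v' => expR (- (h^-1 *
    (enorm v' ^+ 2 / 4 + y / 8 * enorm (v + v') ^+ 2 +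
     enorm (v - v') ^+ 2 / (8 * y) + ell s lx lv x v' ^+ 2 / 2)))).
Proof.
move=> h0 y0; set K0 := 2 * _ * _ * _ * c; set g := h / (4 * y).
have g0 : 0 < g by rewrite divr_gt0// mulr_gt0.
have h20 : 0 < 2 * h by rewrite mulr_gt0.
have hn : h != 0 by rewrite gt_eqF.
have yn : y != 0 by rewrite gt_eqF.
pose N (t : n.-tuple RT) : R := expR (- (y / h * (enorm (2^-1 *: (v + rv t)) ^+ 2 / 2))) *
  gauss h (ell s lx lv x (rv t)).
have N0 t : 0 <= N t by rewrite mulr_ge0 ?expR_ge0// ltW// gauss_gt0.
have N1 t : N t <= 1.
  apply: mulr_ile1.
  - exact: expR_ge0.
  - exact/ltW/gauss_gt0.
  - rewrite -[leRHS]expR0 ler_expR oppr_le0; apply: mulr_ge0.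
      by apply: divr_ge0; exact: ltW.
    by apply: divr_ge0 => //; exact: sqr_ge0.
  - exact: gauss_le1.
have mN : measurable_fun setT N.
  apply: measurable_funM.
    apply: measurable_expRN; apply: measurable_funM => //; apply: measurable_funM => //.
    have := measurable_enorm_affine 2^-1 1 v; congr (measurable_fun _ _).
    by apply/funext => t; rewrite scale1r.
  apply: (measurableT_comp (measurable_gauss h)); apply: measurable_funD => //.
  by apply: measurable_dotp => // i; exact: measurable_rv.
pose F (e t : n.-tuple RT) : R := K0 * (cos (p + dotp (v - rv t) (rv e) / h) * N t *
  (tensor n (gauss g) e * tensor n (gauss (2 * h)) t)).
have FE e t : cos (p + dotp (v - rv t) (rv e) / h) *
      (msym y h (2^-1 *: (v + rv t)) (rv e) * (bphi V s lx lv h x (rv t) * c)) = F e t.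
  rewrite /F /K0 /N !tensor_gauss /msym /bphi /W.
  rewrite (_ : expR (- (y / h * _)) = expR (- (y / h * (enorm (2^-1 *: (v + rv t)) ^+ 2 / 2)))
     * gauss g (enorm (rv e))).
    rewrite (_ : expR (- (_ / h)) = expR (- (V x / (2 * h))) * gauss (2 * h) (enorm (rv t))).
      by ring.
    by rewrite /gauss -expRD; congr expR; field.
  by rewrite /gauss -expRD; congr expR; rewrite /g; field; rewrite hn yn.
have Fi : (leb n \x leb n)%E.-integrable setT (EFin \o (fun z => F z.1 z.2)).
  apply: (@le_integrableR _ _ _ (leb n \x leb n)%E _ (fun z => `|K0| *
     (tensor n (gauss g) z.1 * tensor n (gauss (2 * h)) z.2))).
  - apply: measurable_funM => //; apply: measurable_funM.
      apply: measurable_funM.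
        apply: measurable_cos_phase => i.
          exact: (measurableT_comp (measurable_rv n i) measurable_snd).
        exact: (measurableT_comp (measurable_rv n i) measurable_fst).
      exact: (measurableT_comp mN measurable_snd).
    apply: measurable_funM.
      exact: (measurableT_comp (measurable_tensor_gauss _) measurable_fst).
    exact: (measurableT_comp (measurable_tensor_gauss _) measurable_snd).
  - move=> [e t] /=; rewrite /F normrM ler_wpM2l//.
    have T0 : 0 <= tensor n (gauss g) e * tensor n (gauss (2 * h)) t.
      by rewrite mulr_ge0 ?tensor_gauss_ge0.
    rewrite normrM (ger0_norm T0) -[leRHS]mul1r ler_wpM2r// normrM (ger0_norm (N0 _)).
    apply: mulr_ile1 => //.
    by rewrite ler_norml cos_geN1 cos_le1.
  - have := integrableZl measurableT `|K0| (integrable_prod _ _ _ _ (leb n) (leb n) _ _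
      (integrable_tensor_gauss _ g0) (integrable_tensor_gauss _ h20)).
    by [].
have -> : \int[leb n]_e \int[leb n]_t (cos (p + dotp (v - rv t) (rv e) / h) *
      (msym y h (2^-1 *: (v + rv t)) (rv e) * (bphi V s lx lv h x (rv t) * c))) =
    \int[leb n]_e \int[leb n]_t F e t.
  by apply: eq_Rintegral => e _; apply: eq_Rintegral => t _; exact: FE.
have F12 := Rintegral12_prod _ _ _ _ (leb n) (leb n) _ Fi.
have F21 := Rintegral21_prod _ _ _ _ (leb n) (leb n) _ Fi.
rewrite -[LHS]F12 F21 => {F12 F21}.
set S := Num.sqrt _ ^+ n.
pose M (t : n.-tuple RT) : R := N t * tensor n (gauss (2 * h)) t *
  expR (- (g * enorm (h^-1 *: (v - rv t)) ^+ 2 / 2)).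
have inner t : \int[leb n]_e F e t = (K0 * cos p * S) * M t.
  rewrite (_ : (fun e => F e t) = fun e => (K0 * N t * tensor n (gauss (2 * h)) t) *
    (cos (p + dotp (h^-1 *: (v - rv t)) (rv e)) * tensor n (gauss g) e)); last first.
    by apply/funext => e; rewrite /F dotpZl [h^-1 * _]mulrC; ring.
  rewrite RintegralZl//; last first.
    apply: (@le_integrableR _ _ _ (leb n) _ (tensor n (gauss g))).
    - apply: measurable_funM; last exact: measurable_tensor_gauss.
      apply: (@measurableT_comp _ _ _ _ _ _ (cos : R -> R)).
        by apply: continuous_measurable_fun; exact: continuous_cos.
      apply: measurable_funD => //; apply: measurable_dotp => // i; exact: measurable_rv.
    - move=> e; rewrite normrM (ger0_norm (tensor_gauss_ge0 _ _)) -[leRHS]mul1r.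
      by rewrite ler_wpM2r ?tensor_gauss_ge0// ler_norml cos_geN1 cos_le1.
    - exact: integrable_tensor_gauss.
  by rewrite Rintegral_cos_ridge// -/S /M; ring.
under eq_Rintegral do rewrite inner.
rewrite RintegralZl//; last first.
  apply: (@le_integrableR _ _ _ (leb n) _ (tensor n (gauss (2 * h)))).
  - apply: measurable_funM; first exact: measurable_funM (measurable_tensor_gauss _).
    apply: measurable_expRN; apply: measurable_funM => //; apply: measurable_funM => //.
    have := measurable_enorm_affine h^-1 (-1) v; congr (measurable_fun _ _).
    by apply/funext => t; rewrite scaleN1r.
  - move=> t; rewrite normrM (ger0_norm (expR_ge0 _)) normrM (ger0_norm (N0 _)).
    rewrite (ger0_norm (tensor_gauss_ge0 _ _)) mulrAC -[leRHS]mul1r.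
    apply: ler_wpM2r; first exact: tensor_gauss_ge0.
    apply: mulr_ile1; [exact: N0|exact: expR_ge0|exact: N1|].
    rewrite -[leRHS]expR0 ler_expR oppr_le0; apply: divr_ge0 => //.
    by apply: mulr_ge0; [exact: ltW|exact: sqr_ge0].
  - exact: integrable_tensor_gauss.
congr (_ * _); apply: eq_Rintegral => t _.
rewrite /M /N tensor_gauss /gauss -!expRD; congr expR.
by rewrite !enormZ_sqr /g; field; rewrite hn yn.
Qed.

End operator_formula.

Section weyl.
Context {R : realType} (n : nat).
Local Notation RT := (measurableTypeR R).
Local Notation toC := (real_complex R).
Implicit Types (V : 'rV[R]_n -> R) (s lx lv x v w : 'rV[R]_n) (h y p : R).

(** All half-integer powers of the statement become powers of the two square
roots of 2 pi h and 4y. *)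
Lemma powR_half (a : R) k : 0 <= a -> a `^ (k%:R / 2) = Num.sqrt a ^+ k.
Proof.
by move=> a0; rewrite [_ / 2]mulrC powRrM powR12_sqrt// powR_mulrn// sqrtr_ge0.
Qed.

Lemma Opbphi_constant V s lx lv h y x v r c : 0 < h -> 0 < y ->
  (2 * pi * h) ^- n * ((2 * (y + 1) `^ (n%:R - 2) * h * expR (- (V x / (2 * h))) * c) *
    Num.sqrt (2 * pi * (h / (4 * y))) ^+ n * r) =
  2 * h * (2 * pi * h) `^ (- (n%:R / 2)) * expR (- (V x / (2 * h))) *
  ((y + 1) `^ (n%:R - 2) / (4 * y) `^ (n%:R / 2)) * r * c.
Proof.
move=> h0 y0.
have P0 : 0 < 2 * pi * h by rewrite !mulr_gt0 ?pi_gt0.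
have Y0 : 0 < 4 * y by rewrite mulr_gt0.
rewrite powRN !powR_half ?(ltW P0) ?(ltW Y0)// !mulrA sqrtrM ?(ltW P0)// sqrtrV ?(ltW Y0)//.
rewrite -[in X in X * 2](sqr_sqrtr (ltW P0)).
have q0 : Num.sqrt (2 * pi * h) != 0 by rewrite gt_eqF// sqrtr_gt0.
have u0 : Num.sqrt (4 * y) != 0 by rewrite gt_eqF// sqrtr_gt0.
move: (Num.sqrt (2 * pi * h)) (Num.sqrt (4 * y)) q0 u0 => q u q0 u0.
rewrite -exprM mulnC exprM exprMn exprVn.
have qn : q ^+ n != 0 by rewrite expf_neq0.
have un : u ^+ n != 0 by rewrite expf_neq0.
move: (q ^+ n) (u ^+ n) qn un (expR _) (_ `^ _) => Q U Qn Un e z.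
by field; rewrite Qn Un.
Qed.

(** Entries off the diagonal are treated like the diagonal ones, with constant
(i == j) = 0; the sine part carries the factor cos (pi / 2) = 0. *)
Lemma Oph_mx_bh_phi V s lx lv h y x v : 0 < h -> 0 < y ->
  Oph_mx h (fun w eta => (toC (msym y h w eta))%:M)
           (bh h (fun w => toC (phi V s lx lv h x w))) v =
  toC (Opbphi_coef V s lx lv h y x v) *: map_mx toC lv.
Proof.
move=> h0 y0; rewrite bh_phi//; apply/rowP => i; rewrite !mxE.
have E (j : 'I_n) : Oph h (fun w eta => (toC (msym y h w eta))%:M i j)
    (fun w => (\row_k toC (bphi n V s lx lv h x w * lv 0 k)) 0 j) v =
    toC (Opbphi_coef V s lx lv h y x v * (lv 0 j * (i == j)%:R)).
  rewrite (_ : (fun w eta => _) = fun w eta => toC (msym y h w eta * (i == j)%:R)); last first.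
    by apply/funext => w; apply/funext => eta; rewrite mxE; case: (i == j); rewrite ?mulr1 ?mulr0.
  rewrite (_ : (fun w => _ 0 j) = fun w => toC (bphi n V s lx lv h x w * lv 0 j)); last first.
    by apply/funext => w; rewrite mxE.
  rewrite OphE.
  have F p : \int[leb n]_e \int[leb n]_t (cos (p + dotp (v - rv t) (rv e) / h) *
      (msym y h (2^-1 *: (v + rv t)) (rv e) * (i == j)%:R *
        (bphi n V s lx lv h x (rv t) * lv 0 j))) =
      \int[leb n]_e \int[leb n]_t (cos (p + dotp (v - rv t) (rv e) / h) *
      (msym y h (2^-1 *: (v + rv t)) (rv e) *
        (bphi n V s lx lv h x (rv t) * (lv 0 j * (i == j)%:R)))).
    by apply: eq_Rintegral => e _; apply: eq_Rintegral => t _; ring.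
  rewrite !F !weyl_integral// cos0 cosN cos_pihalf mulr1 mulr0 !mul0r.
  rewrite -[Complex _ 0]/(toC _) -rmorphM; congr toC.
  exact: (Opbphi_constant _ s lx lv).
under eq_bigr do rewrite E.
rewrite (bigD1 i)//= eqxx mulr1 big1 ?addr0; first by rewrite rmorphM.
by move=> j ji; rewrite eq_sym (negbTE ji) !mulr0.
Qed.

End weyl.

(** * The orthogonal projection of phi *)

Section square_integrable.
Context {R : realType} d (T : measurableType d) (m : {measure set T -> \bar R}).

Lemma Lfun2_sqr (f : T -> R) : measurable_fun setT f ->
  m.-integrable setT (EFin \o (fun t => f t ^+ 2)) -> f \in Lfun m 2%:E.
Proof.
move=> mf /integrableP[_ fi]; apply/andP; split; rewrite inE//=.
rewrite /finite_norm unlock /=.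
apply: poweR_lty; apply: le_lt_trans fi.
apply: ge0_le_integral => //.
- apply/measurable_EFinP; apply: (@measurableT_comp _ _ _ _ _ _ (fun x : R => x `^ 2)) => //.
  exact: measurableT_comp.
- by apply/measurable_EFinP; apply: measurableT_comp => //; exact: measurable_funX.
- by move=> t _ /=; rewrite lee_fin powR_mulrn// normrX.
Qed.

Lemma Lfun2_0 : (fun _ : T => 0 : R) \in Lfun m 2%:E.
Proof.
apply: Lfun2_sqr => //; apply: (@le_integrableR _ _ _ m _ (fun=> 0)) => //.
- by move=> t; rewrite expr0n normr0.
- exact: integrable0.
Qed.

End square_integrable.

Section projection.
Context {R : realType} (n : nat).
Local Notation RT := (measurableTypeR R).
Local Notation toC := (real_complex R).
Variables (V : 'rV[R]_n -> R) (s lx lv : 'rV[R]_n) (h : R).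
Hypotheses (h0 : 0 < h) (cV : continuous V).
Hypothesis Vexp : forall a : R, 0 < a ->
  (leb n).-integrable setT (EFin \o (fun t : n.-tuple RT => expR (- (V (rv t) / a)))).

Let K := Num.sqrt (2 * pi * h).
Let l1 (x : 'rV[R]_n) := dotp lx (x - s) / Num.sqrt (1 + enorm lv ^+ 2).

Definition proj_phi (x v : 'rV[R]_n) : R := gprim h (l1 x) * expR (- (W V x v / h)).

Definition proj_coef (x : 'rV[R]_n) : R :=
  (2 * pi * h) `^ (n%:R / 4) * (gprim h (l1 x) * expR (- (V x / (2 * h)))).

Lemma expW x v : expR (- (W V x v / h)) =
  expR (- (V x / (2 * h))) * expR (- (enorm v ^+ 2 / (4 * h))).
Proof.
have hn : h != 0 by rewrite gt_eqF.
by rewrite /W -expRD; congr expR; field.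
Qed.

Lemma proj_phiE x v : proj_phi x v = muh h v * proj_coef x.
Proof.
have P0 : 0 < 2 * pi * h by rewrite !mulr_gt0 ?pi_gt0.
have : (2 * pi * h) `^ (- (n%:R / 4)) * (2 * pi * h) `^ (n%:R / 4) = 1.
  rewrite -powRD ?addNr ?powRr0//; apply/implyP => _.
  by rewrite gt_eqF.
rewrite /proj_phi /muh /proj_coef expW; move: (_ `^ _) (_ `^ _) => a b ab.
rewrite -[LHS]mul1r -ab; ring.
Qed.

Lemma measurable_V : measurable_fun setT (fun t : n.-tuple RT => V (rv t)).
Proof. exact: measurable_continuous_rv. Qed.

(* The same functions are needed on R^{2d}, on R^d_x and on the fibres over x:
measurability is proved along arbitrary measurable x = f(z) and v = g(z). *)
Section measurable_pullback.
Context d (T : measurableType d) (f g : T -> n.-tuple RT).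
Hypotheses (mf : measurable_fun setT f) (mg : measurable_fun setT g).

Let mcf i : measurable_fun setT (fun z => rv (f z) 0 i).
Proof. exact: (measurableT_comp (measurable_rv n i) mf). Qed.

Let mcg i : measurable_fun setT (fun z => rv (g z) 0 i).
Proof. exact: (measurableT_comp (measurable_rv n i) mg). Qed.

Let mlx : measurable_fun setT (fun z => dotp lx (rv (f z) - s)).
Proof.
apply: measurable_dotp => // i.
rewrite (_ : (fun _ => _) = fun z => rv (f z) 0 i - s 0 i); first exact: measurable_funB.
by apply/funext => z; rewrite !mxE.
Qed.

Lemma measurable_l1 : measurable_fun setT (fun z => gprim h (l1 (rv (f z)))).
Proof. by apply: (measurableT_comp (measurable_gprim h)); exact: measurable_funM. Qed.

Lemma measurable_expV a : measurable_fun setT (fun z => expR (- (V (rv (f z)) / a))).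
Proof.
by apply: measurable_expRN; apply: measurable_funM => //; exact: (measurableT_comp measurable_V mf).
Qed.

Lemma measurable_expW : measurable_fun setT (fun z => expR (- (W V (rv (f z)) (rv (g z)) / h))).
Proof.
apply: measurable_expRN; apply: measurable_funM => //; apply: measurable_funD.
  by apply: measurable_funM => //; exact: (measurableT_comp measurable_V mf).
by apply: measurable_funM => //; exact: measurable_enorm.
Qed.

Lemma measurable_phi : measurable_fun setT (fun z => phi V s lx lv h (rv (f z)) (rv (g z))).
Proof.
apply: measurable_funM; last exact: measurable_expW.
apply: (measurableT_comp (measurable_gprim h)); apply: measurable_funD; first exact: mlx.
exact: measurable_dotp.
Qed.

Lemma measurable_proj_phi : measurable_fun setT (fun z => proj_phi (rv (f z)) (rv (g z))).
Proof. by apply: measurable_funM; [exact: measurable_l1|exact: measurable_expW]. Qed.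

Lemma measurable_muh : measurable_fun setT (fun z => muh h (rv (g z))).
Proof.
apply: measurable_funM => //; apply: measurable_expRN; apply: measurable_funM => //.
exact: measurable_enorm.
Qed.

End measurable_pullback.

Lemma expV_sqr (x : 'rV[R]_n) : expR (- (V x / (2 * h))) ^+ 2 = expR (- (V x / h)).
Proof.
have hn : h != 0 by rewrite gt_eqF.
by rewrite expr2 -expRD; congr expR; field.
Qed.

Lemma expN_sqr (t : n.-tuple RT) :
  expR (- (enorm (rv t) ^+ 2 / (4 * h))) ^+ 2 = tensor n (gauss h) t.
Proof.
have hn : h != 0 by rewrite gt_eqF.
by rewrite tensor_gauss /gauss expr2 -expRD; congr expR; field.
Qed.

Lemma gprim_sqr_bound (a : R) : gprim h a ^+ 2 <= K ^+ 2.
Proof. by rewrite -real_normK ?num_real// ler_pXn2r ?nnegrE ?sqrtr_ge0//; exact: gprim_bound. Qed.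

Lemma phi_L2 : L2 (leb2 n) (onR2d (fun x v => toC (phi V s lx lv h x v))).
Proof.
split; last exact: Lfun2_0.
apply: Lfun2_sqr.
  by apply: measurable_phi; [exact: measurable_fst|exact: measurable_snd].
apply: (@le_integrableR _ _ _ (leb2 n) _
    (fun z => K ^+ 2 * (expR (- (V (rv z.1) / h)) * tensor n (gauss h) z.2))).
- apply: measurable_funX; apply: measurable_phi; [exact: measurable_fst|exact: measurable_snd].
- move=> [x v] /=; rewrite ger0_norm ?sqr_ge0// phiE expW !exprMn expV_sqr expN_sqr.
  by rewrite ler_wpM2r ?gprim_sqr_bound// mulr_ge0 ?expR_ge0 ?tensor_gauss_ge0.
- have := integrableZl measurableT (K ^+ 2) (integrable_prod _ _ _ _ (leb n) (leb n) _ _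
    (Vexp h h0) (integrable_tensor_gauss n h h0)).
  by [].
Qed.

Lemma proj_coef_L2 : L2v (fun x => toC (proj_coef x)).
Proof.
split; last exact: Lfun2_0.
have mE : measurable_fun setT (fun t : n.-tuple RT => proj_coef (rv t)).
  apply: measurable_funM => //; apply: measurable_funM.
    exact: (measurable_l1 _ _ id).
  exact: (measurable_expV _ _ id).
apply: Lfun2_sqr; first exact: mE.
apply: (@le_integrableR _ _ _ (leb n) _
    (fun t => (((2 * pi * h) `^ (n%:R / 4)) ^+ 2 * K ^+ 2) * expR (- (V (rv t) / h)))).
- exact: measurable_funX.
- move=> t /=; rewrite ger0_norm ?sqr_ge0// /proj_coef !exprMn expV_sqr mulrA.
  rewrite ler_wpM2r ?expR_ge0// ler_wpM2l ?sqr_ge0//; exact: gprim_sqr_bound.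
- have := integrableZl measurableT (((2 * pi * h) `^ (n%:R / 4)) ^+ 2 * K ^+ 2) (Vexp h h0).
  by [].
Qed.

(** The error function of ell is averaged by [Rintegral_gprim_ridge]; the one of
L_1 is constant in v and is multiplied by the total mass. *)
Lemma fiber_orthogonal x :
  \int[leb n]_t ((phi V s lx lv h x (rv t) - proj_phi x (rv t)) * muh h (rv t)) = 0.
Proof.
have E t : (phi V s lx lv h x (rv t) - proj_phi x (rv t)) * muh h (rv t) =
    (2 * pi * h) `^ (- (n%:R / 4)) * expR (- (V x / (2 * h))) *
    (gprim h (dotp lx (x - s) + dotp lv (rv t)) * tensor n (gauss h) t -
     gprim h (l1 x) * tensor n (gauss h) t).
  by rewrite phiE /proj_phi expW /muh -expN_sqr /ell; ring.
under eq_Rintegral do rewrite E.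
have i1 : (leb n).-integrable setT (EFin \o (fun t : n.-tuple RT =>
    gprim h (dotp lx (x - s) + dotp lv (rv t)) * tensor n (gauss h) t)).
  apply: (@le_integrableR _ _ _ (leb n) _ (fun t => K * tensor n (gauss h) t)).
  - apply: measurable_funM; last exact: measurable_tensor_gauss.
    apply: (measurableT_comp (measurable_gprim h)); apply: measurable_funD => //.
    by apply: measurable_dotp => // i; exact: measurable_rv.
  - move=> t; rewrite normrM (ger0_norm (tensor_gauss_ge0 _ _ _)).
    by rewrite ler_wpM2r ?tensor_gauss_ge0//; exact: gprim_bound.
  - by have := integrableZl measurableT K (integrable_tensor_gauss n h h0).
have i2 : (leb n).-integrable setT (EFin \o (fun t : n.-tuple RT =>
    gprim h (l1 x) * tensor n (gauss h) t)).
  by have := integrableZl measurableT (gprim h (l1 x)) (integrable_tensor_gauss n h h0).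
rewrite RintegralZl//; last by have := integrableB measurableT i1 i2.
rewrite RintegralB// RintegralZl//; last exact: integrable_tensor_gauss.
rewrite Rintegral_gprim_ridge// Rintegral_tensor_gauss// -/(l1 x) mulrC.
by rewrite [X in X - _]mulrC subrr mul0r.
Qed.

(** Fubini with the integral over v inside, where it vanishes by
[fiber_orthogonal]. *)
Lemma orthogonal_muh (r : n.-tuple RT -> R) : r \in Lfun (leb n) 2%:E ->
  \int[leb2 n]_z ((phi V s lx lv h (rv z.1) (rv z.2) - proj_phi (rv z.1) (rv z.2)) *
    muh h (rv z.2) * r z.1) = 0.
Proof.
move=> rL.
have mr : measurable_fun setT r.
  by move: rL => /andP[]; rewrite inE.
pose c := (2 * pi * h) `^ (- (n%:R / 4)).
have c0 : 0 <= c by exact: powR_ge0.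
have K0 : 0 <= K by exact: sqrtr_ge0.
have DE x v : (phi V s lx lv h (rv x) (rv v) - proj_phi (rv x) (rv v)) * muh h (rv v) =
    (gprim h (ell s lx lv (rv x) (rv v)) - gprim h (l1 (rv x))) * c *
    (expR (- (V (rv x) / (2 * h))) * tensor n (gauss h) v).
  by rewrite phiE /proj_phi expW /muh -expN_sqr -/c; ring.
have gc x v : `|(gprim h (ell s lx lv (rv x) (rv v)) - gprim h (l1 (rv x))) * c| <= 2 * K * c.
  rewrite normrM (ger0_norm c0) ler_wpM2r// (le_trans (ler_normB _ _))//.
  by rewrite mulr_natl mulr2n lerD//; exact: gprim_bound.
have mD d (T : measurableType d) (f g : T -> n.-tuple RT) :
    measurable_fun setT f -> measurable_fun setT g -> measurable_fun setT (fun z =>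
    (phi V s lx lv h (rv (f z)) (rv (g z)) - proj_phi (rv (f z)) (rv (g z))) *
      muh h (rv (g z))).
  move=> mf mg; apply: measurable_funM; last exact: measurable_muh.
  by apply: measurable_funB; [exact: measurable_phi|exact: measurable_proj_phi].
have iVr : (leb n).-integrable setT
    (EFin \o (fun t : n.-tuple RT => expR (- (V (rv t) / (2 * h))) * r t)).
  apply/Lfun1_integrable; apply: (@Lfun2_mul_Lfun1 _ _ _ (leb n)) => //.
  apply: Lfun2_sqr; first exact: (measurable_expV _ _ id).
  have := Vexp h h0; congr (integrable _ _ (EFin \o _)).
  by apply/funext => t; rewrite expV_sqr.
set F := fun z : n.-tuple RT * n.-tuple RT => _.
have Fi : (leb n \x leb n)%E.-integrable setT (EFin \o F).
  apply: (@le_integrableR _ _ _ (leb n \x leb n)%E _ (fun z => (2 * K * c) *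
    (`|expR (- (V (rv z.1) / (2 * h))) * r z.1| * tensor n (gauss h) z.2))).
  - apply: measurable_funM; first exact: (mD _ _ fst snd measurable_fst measurable_snd).
    exact: (measurableT_comp mr measurable_fst).
  - move=> [x v]; rewrite /F/= DE -mulrA normrM; apply: ler_pM => //.
    by rewrite !normrM (ger0_norm (tensor_gauss_ge0 _ _ _)) mulrAC.
  - have := integrableZl measurableT (2 * K * c) (integrable_prod _ _ _ _ (leb n) (leb n) _ _
      (integrable_norm iVr) (integrable_tensor_gauss n h h0)).
    by [].
rewrite (Rintegral12_prod _ _ _ _ (leb n) (leb n) _ Fi).
transitivity (\int[leb n]_(t in setT) (0 : R)); last by rewrite Rintegral_cst// mul0r.
apply: eq_Rintegral => x _; rewrite /F/= RintegralZr//.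
  by rewrite fiber_orthogonal mul0r.
apply: (@le_integrableR _ _ _ (leb n) _ (fun v => (2 * K * c) *
    expR (- (V (rv x) / (2 * h))) * tensor n (gauss h) v)).
- exact: (mD _ _ (cst x) id).
- move=> v; rewrite DE normrM -mulrA; apply: ler_pM => //.
  by rewrite ger0_norm// mulr_ge0 ?expR_ge0 ?tensor_gauss_ge0.
- by have := integrableZl measurableT (2 * K * c * expR (- (V (rv x) / (2 * h))))
    (integrable_tensor_gauss n h h0).
Qed.

Lemma orth_proj_phi : orth_proj (muh_L2 h)
  (fun x v => toC (phi V s lx lv h x v)) (fun x v => toC (proj_phi x v)).
Proof.
split; first exact: phi_L2.
  exists (fun x => toC (proj_coef x)); first exact: proj_coef_L2.
  by apply/funext => x; apply/funext => v; rewrite proj_phiE rmorphM.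
move=> q [rho [rhoR rhoI] ->]; rewrite /L2dot /cint.
rewrite (_ : 0 = Complex 0 0 :> R[i])//.
apply: (@f_equal2 R R _ (@Complex R)).
  rewrite -[RHS](orthogonal_muh _ rhoR); apply: eq_Rintegral => -[x v] _.
  by rewrite /onR2d/=; case: (rho (rv x)) => a b /=; ring.
have NrhoI : (fun t : n.-tuple RT => - complex.Im (rho (rv t))) \in Lfun (leb n) 2%:E.
  apply: Lfun2_sqr.
    by apply: (measurableT_comp (@oppr_measurable R setT)); move: rhoI => /andP[]; rewrite inE.
  have := Lfun2_integrable_sqr rhoI; congr (integrable _ _ (EFin \o _)).
  by apply/funext => t; rewrite sqrrN.
rewrite -[RHS](orthogonal_muh _ NrhoI); apply: eq_Rintegral => -[x v] _.
by rewrite /onR2d/=; case: (rho (rv x)) => a b /=; ring.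
Qed.

End projection.

(** * Continuity and conclusion *)

Section continuity.
Context {R : realType} (n : nat) (T : topologicalType).

Lemma continuous_dotp (f g : T -> 'rV[R]_n) :
  (forall i, continuous (fun t => f t 0 i)) ->
  (forall i, continuous (fun t => g t 0 i)) -> continuous (fun t => dotp (f t) (g t)).
Proof.
move=> cf cg z; rewrite /dotp; elim: (index_enum _) => [|i r IH].
  by under eq_fun do rewrite big_nil; exact: cst_continuous.
under eq_fun do rewrite big_cons.
apply: (@continuousD _ _ _ (fun t => f t 0 i * g t 0 i)) => //.
by apply: (@continuousM _ _ (fun t => f t 0 i)); [exact: cf|exact: cg].
Qed.

Lemma continuous_Qphi_comp (V : 'rV[R]_n -> R) s lx lv h (f g : T -> 'rV[R]_n) :
  0 < h -> continuous V -> continuous f -> continuous g ->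
  continuous (fun t => Qphi V s lx lv h (f t) (g t)).
Proof.
move=> h0 cV cf cg.
have co (k : T -> 'rV[R]_n) i : continuous k -> continuous (fun t => k t 0 i).
  move=> ck t; apply: (@continuous_comp _ _ _ k (fun M : 'rV[R]_n => M 0 i)); first exact: ck.
  exact: coord_continuous.
have clx : continuous (fun t => dotp lx (f t - s)).
  apply: continuous_dotp => i; first by move=> t; exact: cst_continuous.
  rewrite (_ : (fun _ => _) = fun t => f t 0 i - s 0 i).
    by move=> t; apply: (@continuousB _ _ _ (fun t => f t 0 i)); [exact: co|exact: cst_continuous].
  by apply/funext => t; rewrite !mxE.
have clv : continuous (fun t => dotp lv (g t)).
  by apply: continuous_dotp => i; [move=> t; exact: cst_continuous|exact: co].
have cN : continuous (fun t => enorm (g t) ^+ 2).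
  rewrite (_ : (fun _ => _) = fun t => dotp (g t) (g t)).
    by apply: continuous_dotp => i; exact: co.
  by apply/funext => t; rewrite enorm_sqr.
have cmul (k : T -> R) a : continuous k -> continuous (fun t => k t * a).
  by move=> ck t; apply: (@continuousM _ _ k (cst a)); [exact: ck|exact: cst_continuous].
have cE : continuous (fun t => expR (- (W V (f t) (g t) / h))).
  move=> t; apply: (@continuous_comp _ _ _ (fun t => - (W V (f t) (g t) / h)) expR).
    apply: (@continuousN _ _ _ (fun t => W V (f t) (g t) / h)).
    apply: (cmul (fun t => W V (f t) (g t))) => u.
    apply: (@continuousD _ _ _ (fun t => V (f t) / 2)).
      apply: (cmul (fun t => V (f t))) => z.
      by apply: (@continuous_comp _ _ _ f V); [exact: cf|exact: cV].
    exact: (cmul (fun t => enorm (g t) ^+ 2)).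
  exact: continuous_expR.
have cG (k : T -> R) : continuous k -> continuous (fun t => gprim h (k t)).
  by move=> ck t; apply: (@continuous_comp _ _ _ k (gprim h)); [exact: ck|exact: continuous_gprim].
rewrite (_ : (fun _ => _) = fun t => (expR (- (W V (f t) (g t) / h)) *
    (gprim h (ell s lx lv (f t) (g t)) -
     gprim h (dotp lx (f t - s) / Num.sqrt (1 + enorm lv ^+ 2)))) * h); last first.
  by apply/funext => t; rewrite QphiE// mulrC.
apply: (cmul (fun t => expR (- (W V (f t) (g t) / h)) * _)) => t.
apply: (@continuousM _ _ (fun t => expR (- (W V (f t) (g t) / h)))); first exact: cE.
apply: (@continuousB _ _ _ (fun t => gprim h (ell s lx lv (f t) (g t)))).
  apply: (cG (fun t => ell s lx lv (f t) (g t))) => u.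
  by apply: (@continuousD _ _ _ (fun t => dotp lx (f t - s))); [exact: clx|exact: clv].
by apply: (cG (fun t => dotp lx (f t - s) / _)); exact: cmul.
Qed.

End continuity.

Lemma H1_continuous (R : realType) n (V : 'rV[R]_n -> R) : H1 V -> continuous V.
Proof. by move=> [sV _ _ _ _ _] x; exact: differentiable_continuous (sV [::] x). Qed.

Lemma H1_integrable_exp (R : realType) n (V : 'rV[R]_n -> R) (a : R) : H1 V -> 0 < a ->
  (leb n).-integrable setT
    (EFin \o (fun t : n.-tuple (measurableTypeR R) => expR (- (V (rv t) / a)))).
Proof.
move=> HV a0; have cV := H1_continuous _ _ _ HV.
case: HV => sV _ [m mV] [C C0 gV] _ _.
have e0 : 0 < (2 * C)^-1 by rewrite invr_gt0 mulr_gt0.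
apply: (@integrable_exp_growth R n V (m - (2 * C)^-1 * C) _ _ cV a0 e0) => x.
have := linear_growth n V m C (sV [::]) mV C0 gV x.
by rewrite mulrBr addrAC addrA.
Qed.

Theorem lemma2p4 (R : realType) (d : nat) (V : 'rV[R]_d -> R)
    (s lx lv : 'rV[R]_d) (h : R) :
  H1 V -> saddle V s -> (forall s', saddle V s' -> s' = s) -> 0 < h ->
  (Qh h (fun x v => real_complex R (phi V s lx lv h x v))
        (fun x v => real_complex R (Qphi V s lx lv h x v)) /\
   continuous (fun z : 'rV[R]_d * 'rV[R]_d => Qphi V s lx lv h z.1 z.2)) /\
  (forall y : R, 0 < y <= 1 -> forall x v : 'rV[R]_d,
    Oph_mx h (fun w eta => (real_complex R (msym y h w eta))%:M)
             (bh h (fun w => real_complex R (phi V s lx lv h x w))) v =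
    real_complex R (Opbphi_coef V s lx lv h y x v) *:
      map_mx (real_complex R) lv).
Proof.
move=> HV _ _ h0; have cV := H1_continuous _ _ _ HV.
split; last by move=> y /andP[y0 _] x v; exact: Oph_mx_bh_phi.
split.
  exists (fun x v => real_complex R (proj_phi d V s lx lv h x v)).
    by apply: orth_proj_phi => // a a0; exact: H1_integrable_exp.
  move=> x v; rewrite -rmorphB -rmorphM QphiE// phiE /proj_phi; congr (real_complex R _).
  by ring.
apply: (continuous_Qphi_comp d _ V s lx lv h fst snd) => //.
- by move=> z; exact: cvg_fst.
- by move=> z; exact: cvg_snd.
Qed.
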